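(* Let $G$ be a nonabelian torsion-free polycyclic-by-finite group and let $k$ be a commutative field. Then the field of fractions of the group algebra $k[G]$ does not contain a noncommutative free field (over any subfield).
   Context: Rings are associative with 1; ''skew field'' means division ring, and subfields may be skew. For such $G$, the group algebra $k[G]$ is a noetherian domain, hence an Ore domain; its field of fractions is its Ore (classical) skew field of fractions $Q$. Free fields: an $n\times n$ matrix over a ring $R$ is full if it is not a product of an $n\times(n-1)$ by an $(n-1)\times n$ matrix over $R$. For a skew field $E$ and a set $X$, the free $E$-ring $E\langle X\rangle$ is the ring generated by $X$ over $E$ subject to the relations $ax=xa$ ($a\in E$, $x\in X$). It is a fir, and its universal field of fractions $E(\langle X\rangle)$ is called the free $E$-field on $X$: up to isomorphism over $E\langle X\rangle$, it is the unique skew field containing $E\langle X\rangle$, generated by it as a skew field, over which every full matrix over $E\langle X\rangle$ is invertible. ''Noncommutative free field'' means one on a set $X$ with at least two elements. That $Q$ does not contain a noncommutative free field over any subfield means: for every skew subfield $E$ of $Q$ and every set $X$ with $|X|\ge 2$, there is no ring embedding $E(\langle X\rangle)\to Q$ which is the identity on $E$. *)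

(* Defs.v *)
From HB Require Import structures.
From mathcomp Require Import all_boot all_algebra.
From mathcomp Require Import finmap monalg.

Set Implicit Arguments.
Unset Strict Implicit.
Unset Printing Implicit Defensive.

Import GRing.Theory.
Local Open Scope ring_scope.

Section Groups.
Variable G : groupType.
Local Open Scope group_scope.

Definition nonabelian := exists x y : G, x * y <> y * x.

Definition torsion_free := forall (x : G) (n : nat), (0 < n)%N -> x ^+ n = 1 -> x = 1.

Definition normal_in (N H : {pred G}) :=
  {subset N <= H} /\ (forall x y, x \in N -> y \in H -> x ^ y \in N).

(* For N normal in H, the quotient H / N is generated by the coset of g: every
   x in H lies in g ^+ n * N or in g ^- n * N for some natural number n. *)
Definition cyclic_quotient (N H : {pred G}) :=
  exists2 g, g \in H & forall x, x \in H ->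
    exists n : nat, (g ^- n * x \in N) || (g ^+ n * x \in N).

Definition polycyclic (P : {pred G}) :=
  exists (n : nat) (H : nat -> groupClosed G),
    [/\ forall x, (x \in H 0) = (x == 1),
        forall x, (x \in H n) = (x \in P)
      & forall i, (i < n)%N ->
          normal_in (H i) (H i.+1) /\ cyclic_quotient (H i) (H i.+1)].

Definition finite_index (N : {pred G}) :=
  exists s : seq G, forall x, exists2 t, t \in s & t^-1 * x \in N.

Definition polycyclic_by_finite :=
  exists N : groupClosed G,
    [/\ polycyclic N, normal_in N predT & finite_index N].

End Groups.

(* The ring structure that monalg puts on {malg R[K]} requires a monoid K without
   nontrivial units, so the convolution product is set up here for a group. *)
Definition group_algebra (k : nzRingType) (G : groupType) : Type := {malg k[G]}.

Section GroupAlgebra.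
Variables (k : nzRingType) (G : groupType).
Local Notation kG := (group_algebra k G).
Local Open Scope fset_scope.
Implicit Types a b c : {malg k[G]}.

Definition ga_one : {malg k[G]} := << 1%g >>.

Definition ga_mul a b : {malg k[G]} :=
  \sum_(x <- msupp a) \sum_(y <- msupp b) << a@_x * b@_y *g (x * y)%g >>.

Lemma ga_mulw (d e : {fset G}) a b : msupp a `<=` d -> msupp b `<=` e ->
  ga_mul a b = \sum_(x <- d) \sum_(y <- e) << a@_x * b@_y *g (x * y)%g >>.
Proof.
move=> le_d le_e; rewrite /ga_mul (big_fset_incl _ le_d) /=.
  apply/eq_bigr=> x _; apply/big_fset_incl => // y _ /mcoeff_outdom ->.
  by rewrite mulr0 monalgU0.
move=> x _ /mcoeff_outdom ax0.
by rewrite big1 // => y _; rewrite ax0 mul0r monalgU0.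
Qed.

Lemma ga_mul0l a : ga_mul 0 a = 0.
Proof. by rewrite /ga_mul msupp0 big_seq_fset0. Qed.

Lemma ga_mul0r a : ga_mul a 0 = 0.
Proof. by rewrite /ga_mul big1 // => x _; rewrite msupp0 big_seq_fset0. Qed.

Lemma ga_mulUU (s t : k) (x y : G) :
  ga_mul << s *g x >> << t *g y >> = << s * t *g (x * y)%g >>.
Proof. by rewrite (ga_mulw msuppU_le msuppU_le) !big_seq_fset1 !mcoeffUU. Qed.

Lemma ga_mulDl : left_distributive ga_mul +%R.
Proof.
move=> a b c.
rewrite (ga_mulw (msuppD_le a b) (fsubset_refl _)).
rewrite (ga_mulw (fsubsetUl (msupp a) (msupp b)) (fsubset_refl (msupp c))).
rewrite (ga_mulw (fsubsetUr (msupp a) (msupp b)) (fsubset_refl (msupp c))).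
rewrite -big_split /=; apply/eq_bigr=> x _.
rewrite -big_split /=; apply/eq_bigr=> y _.
by rewrite mcoeffD mulrDl monalgUD.
Qed.

Lemma ga_mulDr : right_distributive ga_mul +%R.
Proof.
move=> c a b.
rewrite (ga_mulw (fsubset_refl _) (msuppD_le a b)).
rewrite (ga_mulw (fsubset_refl (msupp c)) (fsubsetUl (msupp a) (msupp b))).
rewrite (ga_mulw (fsubset_refl (msupp c)) (fsubsetUr (msupp a) (msupp b))).
rewrite -big_split /=; apply/eq_bigr=> x _.
rewrite -big_split /=; apply/eq_bigr=> y _.
by rewrite mcoeffD mulrDr monalgUD.
Qed.

Lemma ga_mul_suml (I : Type) (r : seq I) (F : I -> {malg k[G]}) b :
  ga_mul (\sum_(i <- r) F i) b = \sum_(i <- r) ga_mul (F i) b.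
Proof. exact: (big_morph (ga_mul^~ b) (fun _ _ => ga_mulDl _ _ _) (ga_mul0l b)). Qed.

Lemma ga_mul_sumr (I : Type) (r : seq I) (F : I -> {malg k[G]}) a :
  ga_mul a (\sum_(i <- r) F i) = \sum_(i <- r) ga_mul a (F i).
Proof. exact: (big_morph (ga_mul a) (fun _ _ => ga_mulDr _ _ _) (ga_mul0r a)). Qed.

Lemma ga_mulA : associative ga_mul.
Proof.
move=> a b c; rewrite [a]monalgE [b]monalgE [c]monalgE.
rewrite !ga_mul_suml; apply: eq_bigr => x _.
rewrite [LHS]ga_mul_sumr [ga_mul << _ *g _ >> (\sum_(y <- msupp b) _)]ga_mul_sumr.
rewrite [RHS]ga_mul_suml; apply: eq_bigr => y _.
rewrite !ga_mul_sumr; apply: eq_bigr => z _.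
by rewrite !ga_mulUU mulrA mulgA.
Qed.

Lemma ga_mul1l : left_id ga_one ga_mul.
Proof.
move=> a; rewrite [a]monalgE ga_mul_sumr; apply: eq_bigr => x _.
by rewrite ga_mulUU mul1r mul1g.
Qed.

Lemma ga_mul1r : right_id ga_one ga_mul.
Proof.
move=> a; rewrite [a]monalgE ga_mul_suml; apply: eq_bigr => x _.
by rewrite ga_mulUU mulr1 mulg1.
Qed.

Lemma ga_one_neq0 : ga_one != 0.
Proof. by rewrite monalgU_eq0 oner_eq0. Qed.

HB.instance Definition _ := GRing.Zmodule.on kG.
HB.instance Definition _ := GRing.Zmodule_isNzRing.Build kG
  ga_mulA ga_mul1l ga_mul1r ga_mulDl ga_mulDr ga_one_neq0.

End GroupAlgebra.

Definition skew_field (D : unitRingType) := GRing.field_axiom D.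

(* The skew subfield of Q with carrier S, as a ring in its own right. *)
Record subskewfield (Q : unitRingType) (S : divringClosed Q) := Subskewfield {
  subskewfield_val : Q;
  _ : subskewfield_val \in S
}.

Section SubSkewField.
Variables (Q : unitRingType) (S : divringClosed Q).
HB.instance Definition _ := [isSub for @subskewfield_val Q S].
HB.instance Definition _ := [Choice of subskewfield S by <:].
HB.instance Definition _ := [SubChoice_isSubUnitRing of subskewfield S by <:].
End SubSkewField.

Definition ore_field_of_fractions (R : nzRingType) (Q : unitRingType)
    (i : {rmorphism R -> Q}) :=
  [/\ skew_field Q, injective i,
      forall q : Q, exists a b : R, b != 0 /\ q = i a * (i b)^-1
    & forall q : Q, exists a b : R, b != 0 /\ q = (i b)^-1 * i a].

(* {fmonom X} is the free monoid on X, and the coefficients commute with the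
   words: this is the ring generated by X over E subject to a x = x a. *)
Definition free_ring (E : nzRingType) (X : choiceType) : Type := {malg E[{fmonom X}]}.
HB.instance Definition _ (E : nzRingType) (X : choiceType) :=
  GRing.NzRing.on (free_ring E X).

Definition free_ringC (E : nzRingType) (X : choiceType) (e : E) : free_ring E X :=
  (e%:MP : {malg E[{fmonom X}]}).

(* The 0 x 0 matrix is left out: the condition has no meaning in size 0. *)
Definition full (R : nzRingType) (n : nat) (A : 'M[R]_n.+1) :=
  forall (B : 'M[R]_(n.+1, n)) (C : 'M[R]_(n, n.+1)), A <> B *m C.

(* unitmx is only available over commutative rings. *)
Definition invertible_mx (R : nzRingType) (n : nat) (A : 'M[R]_n) :=
  exists B : 'M[R]_n, A *m B = 1%:M /\ B *m A = 1%:M.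

Definition free_field (E : nzRingType) (X : choiceType) (U : unitRingType)
    (j : {rmorphism free_ring E X -> U}) :=
  [/\ skew_field U, injective j,
      forall S : divringClosed U, (forall p, j p \in S) -> forall u : U, u \in S
    & forall (n : nat) (A : 'M[free_ring E X]_n.+1),
        full A -> invertible_mx (map_mx j A)].

Definition contains_noncommutative_free_field (Q : unitRingType) :=
  exists (S : divringClosed Q) (X : choiceType) (U : unitRingType)
         (j : {rmorphism free_ring (subskewfield S) X -> U}),
    [/\ exists x y : X, x <> y,
        free_field j
      & exists f : {rmorphism U -> Q}, injective f /\
          forall e : subskewfield S, f (j (free_ringC X e)) = val e].

(* Main.v *)
Require Import Defs.
From HB Require Import structures.
From mathcomp Require Import all_boot all_algebra.
From mathcomp Require Import finmap monalg.
From mathcomp Require Import boolp zify.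
Set Implicit Arguments.
Unset Strict Implicit.
Unset Printing Implicit Defensive.
Import GRing.Theory.
Local Open Scope ring_scope.

(** The proof compares how fast finite-dimensional subspaces grow under right
multiplication by two elements x and y.

In a free field subspaces grow fast: if x and y are two of the free generators
over E and V is a nonzero finite-dimensional right E-subspace of a skew field that
contains the free field, then V + Vx + Vy has dimension more than twice that of
V ([free_field_doubles]).  In the field of fractions Q of a group algebra k[G]
with G polycyclic-by-finite they can be made to grow slowly.  Such a group has
Foelner sets F ([foelner_polycyclic_by_finite]); writing x = c^-1 a and
y = c^-1 b with a, b, c in k[G], the space V = span(F) c satisfies
V + Vx + Vy = span(F) c + span(F) a + span(F) b, which is hardly larger
than V ([deficient_exists]).

The two facts concern different scalars: the second is about subspaces over a
central field, whereas E is an arbitrary skew subfield of Q.  Three steps bridge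
the gap.

First, everything is done over the central field K of those elements of k that
lie in E.  The dimension of k over K may be infinite, so the coefficients
of a, b, c have to be handled as well; finitely generated commutative algebras
have polynomial growth, which provides almost invariant K-subspaces of k
([commutative_foelner]).

Second, among the K-subspaces V with dim(V + Vx + Vy) < 2 dim V one takes V of
minimal dimension, and moves it so that it contains 1.  A K-linear map that
commutes with right multiplication by x and y is either injective or zero on V,
since otherwise its kernel or its image would be a smaller example
([minimal_map_zero]).  For e in E the map v |-> ve - ev is of this kind and
kills 1, so V centralizes E ([minimal_centralizes]).  For subspaces that
centralize E, independence over E is the same as independence over the centre Z
of E ([indep_over_centre]).

Third, one passes from K to Z.  Minimality gives, for every finite-dimensional D
inside Z, the inequality dim(VD + VDx + VDy) <= 2 dim VD over K
([minimal_multiples]).  Taking for D almost invariant subspaces of the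
commutative field Z and dividing by dim D yields the same inequality for the
dimensions of VZ over Z ([deficient_over_extension]), which contradicts the
growth in the free field.

The growth in the free field comes from its universal property.  The relations
that express V, Vx and Vy through a basis u of V + Vx + Vy form a matrix L over
the free ring with uL = 0.  Because full matrices become invertible, L factors
through fewer columns than u has entries, the first factor still being killed
by u ([kernel_factors]).  If u had at most 2 dim V entries, some nonzero constant
combination of the columns of the second factor would have augmentation zero, and
Fox derivatives of the same combination of the columns of L would produce a linear
relation between the basis elements of V ([free_pair_doubles]). *)

(** * Linear algebra over a skew subfield *)

Section LinearAlgebra.
Variables (Q : unitRingType) (QF : skew_field Q) (K : divringClosed Q).
Implicit Types (s t : seq Q) (u v : Q) (f : Q -> Q).

(** Subfields act on Q by left multiplication.  Spans and independence are
defined by recursion on the list of vectors, because every dimension count below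
is an induction on such a list. *)
Fixpoint lspan s v : Prop :=
  if s is a :: s' then exists2 c, c \in K & lspan s' (v - c * a) else v = 0.

Fixpoint indep s : Prop :=
  if s is a :: s' then indep s' /\ ~ lspan s' a else True.

Definition linear_over f :=
  (forall u v, f (u + v) = f u + f v) /\ forall c v, c \in K -> f (c * v) = c * f v.

Lemma span0 s : lspan s 0.
Proof. by elim: s => //= a s IH; exists 0; rewrite ?rpred0 // mul0r subr0. Qed.

Lemma spanD s u v : lspan s u -> lspan s v -> lspan s (u + v).
Proof.
elim: s u v => [|a s IH] u v /=; first by move=> -> ->; rewrite addr0.
move=> [c cK su] [d dK sv]; exists (c + d); first exact: rpredD.
by rewrite mulrDl opprD addrACA; apply: IH.
Qed.

Lemma spanZ s c v : c \in K -> lspan s v -> lspan s (c * v).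
Proof.
move=> cK; elim: s v => [|a s IH] v /=; first by move=> ->; rewrite mulr0.
by move=> [d dK sv]; exists (c * d); rewrite ?rpredM // -mulrA -mulrBr; apply: IH.
Qed.

Lemma spanN s v : lspan s v -> lspan s (- v).
Proof. by move=> sv; rewrite -mulN1r; apply: spanZ; rewrite // rpredN1. Qed.

Lemma spanB s u v : lspan s u -> lspan s v -> lspan s (u - v).
Proof. by move=> su sv; apply: spanD => //; apply: spanN. Qed.

Lemma span_mem s v : v \in s -> lspan s v.
Proof.
elim: s => //= a s IH; rewrite inE => /orP[/eqP->|/IH sv].
  by exists 1; rewrite ?rpred1 // mul1r subrr; apply: span0.
by exists 0; rewrite ?rpred0 // mul0r subr0.
Qed.

Lemma span_ind (P : Q -> Prop) s : P 0 -> (forall u v, P u -> P v -> P (u + v)) ->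
    (forall c v, c \in K -> P v -> P (c * v)) ->
    (forall v, v \in s -> P v) -> forall v, lspan s v -> P v.
Proof.
move=> P0 PD PZ; elim: s => [|a s IH] Ps v /=; first by move=> ->.
move=> [c cK sv]; rewrite -(subrK (c * a) v); apply: PD.
  by apply: IH => // w ws; apply: Ps; rewrite inE ws orbT.
by apply: PZ => //; apply: Ps; rewrite mem_head.
Qed.

Lemma span_trans s t v : (forall w, w \in s -> lspan t w) -> lspan s v -> lspan t v.
Proof.
move=> st; apply: (span_ind (P := lspan t)) => //; [exact: span0|exact: spanD|exact: spanZ].
Qed.

Lemma span_sub s t v : {subset s <= t} -> lspan s v -> lspan t v.
Proof. by move=> st; apply: span_trans => w /st; apply: span_mem. Qed.

Lemma span_cat s t v : lspan (s ++ t) v <-> exists2 u, lspan s u & lspan t (v - u).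
Proof.
elim: s v => [|a s IH] v /=.
  by split=> [tv|[u -> ]]; [exists 0|]; rewrite ?subr0.
split=> [[c cK /IH[u su tv]]|[u [c cK su] tv]].
  exists (u + c * a); last by rewrite opprD (addrC (- u)) addrA.
  by exists c; rewrite ?addrK.
exists c => //; apply/IH; exists (u - c * a) => //.
by rewrite opprB addrA subrK.
Qed.

Lemma linear_overB f u v : linear_over f -> f (u - v) = f u - f v.
Proof.
by move=> [fD fZ]; rewrite fD -mulN1r fZ ?rpredN1 // mulN1r.
Qed.

Lemma linear_over0 f : linear_over f -> f 0 = 0.
Proof. by move=> fL; rewrite -{1}(subrr 0) linear_overB // subrr. Qed.

Lemma span_map f s v : linear_over f -> lspan s v -> lspan (map f s) (f v).
Proof.
move=> fL; elim: s v => [|a s IH] v /=; first by move=> ->; rewrite linear_over0.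
by move=> [c cK /IH]; rewrite linear_overB // fL.2 // => sv; exists c.
Qed.

Lemma span_mapP f s v :
  linear_over f -> lspan (map f s) v -> exists2 u, lspan s u & v = f u.
Proof.
move=> fL; elim: s v => [|a s IH] v /=; first by move=> ->; exists 0; rewrite ?linear_over0.
move=> [c cK /IH[u su Dv]]; exists (u + c * a); first by exists c; rewrite ?addrK.
by rewrite fL.1 fL.2 // -Dv subrK.
Qed.

Lemma span_exchange s a b : lspan (a :: s) b -> ~ lspan s b -> lspan (b :: s) a.
Proof.
move=> [c cK sb] nsb.
have c0 : c != 0 by apply/eqP => c0; apply: nsb; rewrite c0 mul0r subr0 in sb.
exists c^-1; first by rewrite rpredV.
have -> : a - c^-1 * b = - (c^-1 * (b - c * a)).
  by rewrite mulrBr mulKr ?QF // opprB.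
by apply: spanN; apply: spanZ => //; rewrite rpredV.
Qed.

Lemma indep_swap a b s : indep (a :: b :: s) -> indep (b :: a :: s).
Proof.
move=> /= [[is_ nb] na].
have na' : ~ lspan s a by move=> sa; apply: na; exists 0; rewrite ?rpred0 // mul0r subr0.
by split=> // /span_exchange /(_ nb) /na.
Qed.

Lemma indep_move s a t : indep (s ++ a :: t) <-> indep (a :: s ++ t).
Proof.
have eqs r b : lspan (r ++ a :: t) b <-> lspan (a :: r ++ t) b.
  by split; apply: span_sub => w; rewrite !(mem_cat, inE) orbCA.
elim: s => // b s IH; split=> [[/IH i_ nb]|/indep_swap[i_ nb]].
  by apply: indep_swap; split=> // /eqs.
by split; [apply/IH|move=> /eqs].
Qed.

(** Exchange argument: [u] collects the vectors of [s] that have already replaced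
vectors of [t]. *)
Lemma steinitz s t : indep s -> (forall v, v \in s -> lspan t v) -> (size s <= size t)%N.
Proof.
suff: forall u : seq Q, indep (s ++ u) -> (forall v, v \in s -> lspan (t ++ u) v) ->
    (size s <= size t)%N.
  by move=> /(_ [::]); rewrite !cats0.
elim: t s => [|b t IH] s u is_ st.
  case: s is_ st => //= a s [_ na] /(_ a); rewrite mem_head => /(_ isT) ua.
  by case: na; apply: span_sub ua => w; rewrite mem_cat orbC => ->.
have [all_s|] := pselect (forall v, v \in s -> lspan (t ++ u) v).
  by apply: leqW; apply: IH all_s.
move=> /existsNP[a /not_implyP[as_ na]].
have bs : lspan (a :: t ++ u) b by apply: span_exchange na; apply: st.
case/splitPr: as_ is_ st => s1 s2 is_ st.
rewrite size_cat /= addnS -size_cat ltnS; apply: (IH _ (a :: u)).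
  by apply/indep_move; rewrite -catA; apply/indep_move; rewrite -catA in is_.
move=> v; rewrite mem_cat => vs.
have: lspan (b :: t ++ u) v by apply: st; rewrite mem_cat inE orbCA vs orbT.
apply: span_trans => w; rewrite inE => /orP[/eqP->|].
  by apply: span_sub bs => z; rewrite !(inE, mem_cat) orbCA.
by rewrite mem_cat => wtu; apply: span_mem; rewrite !(mem_cat, inE) orbCA wtu orbT.
Qed.

(** A relative rank-nullity theorem.  The vectors [s2] span the part of the span
of [p] that [f] sends into the span of [al], and the images of [s1] stay
independent modulo that span.  As [size s1 + size s2 = size p] holds for any list
[p], the statement bounds dimensions from above when [p] is only a spanning list
and computes them when [p] is a basis. *)
Lemma split_along f p al : linear_over f -> exists s1 s2,
  [/\ (size s1 + size s2 = size p)%N /\ {subset s1 <= p},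
      forall v, lspan p v <-> lspan (s1 ++ s2) v,
      forall v, v \in s2 -> lspan al (f v),
      forall v, lspan p v -> lspan al (f v) -> lspan s2 v &
      (indep al -> indep (map f s1 ++ al)) /\ (indep p -> indep s2)].
Proof.
move=> fL.
(* The fourth clause holds as soon as no nonzero combination of [s1] is sent
   into the span of [al]. *)
suff: exists s1 s2,
  [/\ (size s1 + size s2 = size p)%N /\ {subset s1 <= p},
      forall v, lspan p v <-> lspan (s1 ++ s2) v,
      forall v, v \in s2 -> lspan al (f v),
      forall u, lspan s1 u -> lspan al (f u) -> u = 0 &
      (indep al -> indep (map f s1 ++ al)) /\ (indep p -> indep s2)].
  move=> [s1 [s2 [sz sp s2al s1al ind]]]; exists s1, s2; split=> // v pv alv.
  have/span_cat[u s1u s2u] : lspan (s1 ++ s2) v by apply/sp.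
  suff u0 : u = 0 by rewrite u0 subr0 in s2u.
  apply: s1al => //.
  have alu : lspan al (f (v - u)).
    apply: (span_ind (P := fun w => lspan al (f w))) s2u => //.
    - by rewrite linear_over0 //; apply: span0.
    - by move=> w1 w2 h1 h2; rewrite fL.1; apply: spanD.
    - by move=> c w cK h; rewrite fL.2 //; apply: spanZ.
  by have := spanB alv alu; rewrite linear_overB // opprB addrC subrK.
elim: p => [|a p [s1 [s2 [[sz sub1] sp s2al s1al [ind1 ind2]]]]].
  by exists [::], [::]; split=> // u /= ->.
have [/span_cat[_ /(span_mapP fL)[u s1u ->] alau]|na] :=
    pselect (lspan (map f s1 ++ al) (f a)).
  exists s1, ((a - u) :: s2); split=> //.
  - by split=> [|v /sub1 vp]; rewrite ?inE ?vp ?orbT //= addnS sz.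
  - have pu : lspan p u.
      by apply/sp; apply: span_sub s1u => w; rewrite mem_cat => ->.
    have s12u : lspan (s1 ++ (a - u) :: s2) u.
      by apply: span_sub s1u => w; rewrite mem_cat => ->.
    have sub w : lspan (s1 ++ s2) w -> lspan (s1 ++ (a - u) :: s2) w.
      by apply: span_sub => z; rewrite !mem_cat inE => /orP[->|->]; rewrite ?orbT.
    move=> v; split; apply: span_trans => w; rewrite ?mem_cat inE.
      move=> /orP[/eqP->|wp].
        rewrite -[X in lspan _ X](subrK u a); apply: spanD => //.
        by apply: span_mem; rewrite mem_cat mem_head orbT.
      by apply: sub; apply/sp; apply: span_mem.
    rewrite orbCA => /orP[/eqP->|ws].
      apply: spanB; first by apply: span_mem; rewrite mem_head.
      by apply: span_sub pu => z zp; rewrite inE zp orbT.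
    have: lspan p w by apply/sp; apply: span_mem; rewrite mem_cat.
    by apply: span_sub => z zp; rewrite inE zp orbT.
  - by move=> v; rewrite inE => /orP[/eqP->|/s2al//]; rewrite linear_overB.
  split=> // -[/ind2 is2 npa]; split=> //= s2au; apply: npa; apply/sp.
  by apply/span_cat; exists u.
exists (a :: s1), s2; split=> //=.
- split=> [|v]; first by rewrite addSn sz.
  by rewrite !inE => /orP[->//|/sub1->]; rewrite orbT.
- by move=> v; split=> -[c cK /sp h]; exists c.
- move=> u [c cK s1u] alu.
  have c0 : c = 0.
    apply/eqP; apply/negP => /negP c0; apply: na; apply/span_cat.
    exists (f (- (c^-1 * (u - c * a)))).
      by apply: span_map => //; apply: spanN; apply: spanZ => //; rewrite rpredV.
    rewrite -linear_overB // opprK mulrBr mulKr ?QF // addrC subrK.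
    by rewrite fL.2 ?rpredV //; apply: spanZ; rewrite ?rpredV.
  by rewrite c0 mul0r subr0 in s1u; apply: s1al.
- by split=> [/ind1|[/ind2]].
Qed.

Lemma linear_over_id : linear_over id. Proof. by []. Qed.

Lemma basis_of_list p : exists s,
  [/\ indep s, (size s <= size p)%N, {subset s <= p} & forall v, lspan s v <-> lspan p v].
Proof.
have [s1 [s2 [[sz sub1] sp s20 _ [i1 _]]]] := split_along p [::] linear_over_id.
exists s1; split; first by have := i1 I; rewrite cats0 map_id.
- by rewrite -sz leq_addr.
- exact: sub1.
move=> v; split=> [h|/sp].
  by apply/sp; apply: span_sub h => w; rewrite mem_cat => ->.
apply: span_trans => w; rewrite mem_cat => /orP[|/s20 /= ->]; first exact: span_mem.
exact: span0.
Qed.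

Lemma span_coef s v : lspan s v ->
  exists2 c : 'I_(size s) -> Q, (forall i, c i \in K) & v = \sum_i c i * s`_i.
Proof.
elim: s v => [|a s IH] v /=; first by move=> ->; exists (fun=> 0); [case|rewrite big_ord0].
move=> [c cK /IH[d dK Dv]].
exists (fun i => if unlift ord0 i is Some j then d j else c).
  by move=> i; case: unliftP.
rewrite big_ord_recl unlift_none /= -(subrK (c * a) v) Dv addrC; congr (_ + _).
by apply: eq_bigr => i _; rewrite liftK.
Qed.

Lemma span_sum (n : nat) s (c : 'I_n -> Q) (w : 'I_n -> Q) :
  (forall i, c i \in K) -> (forall i, lspan s (w i)) -> lspan s (\sum_i c i * w i).
Proof.
move=> cK sw; apply: (big_ind (lspan s)); [exact: span0|exact: spanD|].
by move=> i _; apply: spanZ.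
Qed.

Lemma indep_coef s (c : 'I_(size s) -> Q) : indep s -> (forall i, c i \in K) ->
  \sum_i c i * s`_i = 0 -> forall i, c i = 0.
Proof.
elim: s c => [|a s IH] c /=; first by move=> _ _ _ [].
move=> [is_ na] cK; rewrite big_ord_recl /= => c0.
have sS : lspan s (\sum_(i < size s) c (lift ord0 i) * s`_i).
  by apply: span_sum => // i; apply: span_mem; apply: mem_nth.
have c00 : c ord0 = 0.
  apply/eqP; apply/negP => /negP nc; apply: na.
  rewrite -(mulKr (QF nc) a).
  rewrite -(addrK (\sum_(i < size s) c (lift ord0 i) * s`_i) (_ * a)) c0 sub0r.
  by apply: spanZ; rewrite ?rpredV //; apply: spanN.
move=> i; case: (unliftP ord0 i) => [j ->|->//].
by apply: (IH (fun j => c (lift ord0 j))) => //; rewrite -[RHS]c0 c00 mul0r add0r.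
Qed.

End LinearAlgebra.

Section Tower.
Variables (Q : unitRingType) (QF : skew_field Q) (K L : divringClosed Q).
Hypothesis KL : {subset K <= L}.

Lemma span_le s v : lspan K s v -> lspan L s v.
Proof. by elim: s v => //= a s IH v [c /KL cL /IH]; exists c. Qed.

(** The dimension of a tower of fields, in the form of a lower bound: products of
independent scalars with independent vectors are independent. *)
Lemma tower_indep (w m : seq Q) : indep L w -> indep K m -> {subset m <= L} ->
  indep K [seq b * v | v <- w, b <- m].
Proof.
move=> + im mL; elim: w => //= v w IH [/IH iw nv].
set r := [seq b * v' | v' <- w, b <- m] in iw *.
have rL u : lspan K r u -> lspan L w u.
  move=> /span_le; apply: span_trans => _ /allpairsP[[v' b] /= [v'w bm ->]].
  by apply: spanZ; [exact: mL|exact: span_mem].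
have multL : linear_over K ( *%R^~ v).
  by split=> [a b|c b cK]; rewrite ?mulrDl ?mulrA.
clearbody r; elim: m im mL {IH} => //= b m IHm [im nb] mL.
have mL' : {subset m <= L} by move=> z zm; apply: mL; rewrite inE zm orbT.
split; first exact: IHm.
move=> /span_cat[_ /(span_mapP multL)[c mc ->] rb]; apply: nv.
have cL : c \in L.
  move: mc; apply: (span_ind (P := fun z => z \in L)); rewrite ?rpred0 //.
  - by move=> *; apply: rpredD.
  - by move=> a z /KL aL zL; apply: rpredM.
have bc0 : b - c != 0 by rewrite subr_eq0; apply/eqP => bc; apply: nb; rewrite bc.
rewrite -(mulKr (QF bc0) v); apply: spanZ.
  by rewrite rpredV rpredB // mL // mem_head.
by apply: rL; rewrite mulrBl.
Qed.

End Tower.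

(** * Almost invariant subspaces of commutative fields *)

(** A polynomially bounded sequence cannot grow by a factor (c+1)/c at every step:
over c steps it would at least double, by Bernoulli's inequality. *)
Lemma slow_growth (c r : nat) (d : nat -> nat) : (forall M, 0 < d M)%N ->
  (forall M, d M <= M.+1 ^ r)%N -> exists M, (c * d M.+1 <= c.+1 * d M)%N.
Proof.
move=> d0 dr; apply/not_existsP => grow.
have {}grow M : (c.+1 * d M < c * d M.+1)%N by rewrite ltnNge; apply/negP/grow.
have c0 : (0 < c)%N by have := grow 0; case: (c).
have exp_mono m n k : (m <= n)%N -> (m ^ k <= n ^ k)%N.
  by move=> mn; elim: k => // k IH; rewrite !expnS; apply: leq_mul.
have grow_iter M : (c.+1 ^ M <= c ^ M * d M)%N.
  elim: M => [|M IH]; first by rewrite !expn0 mul1n.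
  rewrite !expnS; have := grow M; nia.
have bernoulli : (2 * c ^ c <= c.+1 ^ c)%N.
  have H m : (c ^ m * (c + m) <= c.+1 ^ m * c)%N.
    elim: m => [|m IH]; first by rewrite !expn0 addn0.
    by rewrite !expnS; nia.
  by have := H c; nia.
have exp_le t : (2 ^ t <= d (c * t))%N.
  have H : (2 ^ t * c ^ (c * t) <= c.+1 ^ (c * t))%N.
    by rewrite !expnM -expnMn; apply: exp_mono.
  have := leq_trans H (grow_iter (c * t)%N).
  by rewrite mulnC leq_pmul2l // expn_gt0 c0.
have lin u : (2 ^ u <= (c + u) * r)%N.
  rewrite -(@leq_exp2l 2) //; apply: leq_trans (exp_le _) _.
  apply: leq_trans (dr _) _; rewrite expnM; apply: exp_mono.
  by rewrite expnD; have := ltn_expl c (isT : 1 < 2)%N; have := expn_gt0 2 u; nia.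
(* At u = 2v the left side is at least (v+1)^2 and the right side at most v^2. *)
set v := (c + 3 * r)%N; have v2 := ltn_expl v (isT : 1 < 2)%N.
have h1 : (v.+1 * v.+1 <= 2 ^ v * 2 ^ v)%N by apply: leq_mul.
have h2 : ((c + (v + v)) * r <= v * v)%N.
  have /leq_trans : ((c + (v + v)) * r <= (3 * r) * v)%N by rewrite /v; nia.
  by apply; rewrite leq_mul2r /v leq_addl orbT.
have := lin (v + v)%N; rewrite expnD; lia.
Qed.

Section CommutativeFoelner.
Variables (Q : unitRingType) (QF : skew_field Q) (K L : divringClosed Q).
Hypothesis KL : {subset K <= L}.
Hypothesis Lcomm : {in L &, forall a b : Q, a * b = b * a}.

(** Exponents are bounded separately for each generator, so the number of
monomials is plainly polynomial in [M]. *)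
Fixpoint monomials (a : seq Q) (M : nat) : seq Q :=
  if a is b :: a' then [seq b ^+ j * m | j <- iota 0 M.+1, m <- monomials a' M]
  else [:: 1].

Lemma monomials_cons b a M j m : (j <= M)%N -> m \in monomials a M ->
  b ^+ j * m \in monomials (b :: a) M.
Proof.
move=> jM mM; apply: (allpairs_f (fun j m => b ^+ j * m)) => //.
by rewrite mem_iota add0n ltnS.
Qed.

Lemma monomials_consP b a M m : m \in monomials (b :: a) M ->
  exists j m', [/\ (j <= M)%N, m' \in monomials a M & m = b ^+ j * m'].
Proof.
move=> /allpairsP[[j m'] [jM m'M ->]]; exists j, m'; split=> //.
by move: jM; rewrite mem_iota add0n ltnS.
Qed.

Lemma size_monomials a M : size (monomials a M) = (M.+1 ^ size a)%N.
Proof.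
elim: a => // b a IH; rewrite expnS -IH.
transitivity (size (iota 0 M.+1) * size (monomials a M))%N; last by rewrite size_iota.
exact: size_allpairs.
Qed.

Lemma monomials_sub a M : {subset a <= L} -> {subset monomials a M <= L}.
Proof.
elim: a => [|b a IH] aL m; first by rewrite inE => /eqP->; apply: rpred1.
move=> /monomials_consP[j [m' [_ m'M ->]]]; rewrite rpredM //.
  by rewrite rpredX // aL // mem_head.
by apply: IH => // c ca; apply: aL; rewrite inE ca orbT.
Qed.

Lemma monomials_le a M N : (M <= N)%N -> {subset monomials a M <= monomials a N}.
Proof.
move=> MN; elim: a => // b a IH m /monomials_consP[j [m' [jM m'M ->]]].
by apply: monomials_cons; [apply: leq_trans MN|apply: IH].
Qed.

Lemma monomials_mul a M b : {subset a <= L} -> b \in a ->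
  forall m, m \in monomials a M -> m * b \in monomials a M.+1.
Proof.
elim: a => // b' a IH aL ba _ /monomials_consP[j [m' [jM m'M ->]]].
have aL' : {subset a <= L} by move=> c ca; apply: aL; rewrite inE ca orbT.
move: ba; rewrite inE => /orP[/eqP Eb|ba].
  have -> : b' ^+ j * m' * b = b' ^+ j.+1 * m'.
    rewrite Eb exprSr -!mulrA; congr (_ * _); apply: Lcomm.
      exact: monomials_sub m'M.
    by apply: aL; rewrite mem_head.
  by apply: monomials_cons => //; apply: monomials_le m'M; apply: leqnSn.
by rewrite -mulrA; apply: monomials_cons; [apply: leqW|apply: IH].
Qed.

(** The spans of the monomials of bounded degree have polynomially bounded
dimension, so two consecutive ones must have nearly equal dimensions. *)
Lemma commutative_foelner (a : seq Q) (c : nat) : {subset a <= L} ->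
  exists D D' : seq Q,
  [/\ indep K D, {subset D <= L} /\ {subset D' <= L}, (0 < size D)%N,
      forall m b, m \in D -> b \in a -> lspan K D' (m * b) &
      (c * size D' <= c.+1 * size D)%N].
Proof.
move=> aL.
have basis M : exists s, [/\ indep K s, (size s <= M.+1 ^ size a)%N &
    forall v, lspan K s v <-> lspan K (monomials a M) v].
  rewrite -size_monomials.
  by have [s [is_ szs _ sp]] := basis_of_list QF K (monomials a M); exists s.
pose B M := projT1 (cid (basis M)).
have BP M : [/\ indep K (B M), (size (B M) <= M.+1 ^ size a)%N &
    forall v, lspan K (B M) v <-> lspan K (monomials a M) v].
  by rewrite /B; case: cid.
have subL M s : lspan K (monomials a M) s -> s \in L.
  apply: (span_ind (P := fun z => z \in L)); rewrite ?rpred0 //.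
  - by move=> *; apply: rpredD.
  - by move=> u v /KL uL vL; apply: rpredM.
  - by move=> v; apply: monomials_sub.
have B_gt0 M : (0 < size (B M))%N.
  case E : (B M) => //; have [_ _ sp] := BP M.
  have /sp : lspan K (monomials a M) 1.
    apply: span_mem; elim: (a) => [|b a' IH]; first by rewrite inE.
    by rewrite -[1]mulr1; apply: (@monomials_cons _ _ _ 0%N).
  by rewrite E /= => /eqP; rewrite oner_eq0.
have [//||M HM] := @slow_growth c (size a) (fun M => size (B M)).
  by move=> M; have [] := BP M.
have [i1 _ sp1] := BP M; have [_ _ sp2] := BP M.+1.
exists (B M), (B M.+1); split=> //.
- by split=> v vB; [apply: (subL M); apply/sp1|apply: (subL M.+1); apply/sp2]; apply: span_mem.
move=> m b mB ba; apply/sp2.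
have mulL : linear_over K ( *%R^~ b) by split=> [u v|u v _]; rewrite ?mulrDl ?mulrA.
have := span_map mulL (proj1 (sp1 m) (span_mem K mB)).
apply: span_trans => _ /mapP[m' m'M ->]; apply: span_mem.
exact: monomials_mul.
Qed.
End CommutativeFoelner.

(** * Foelner sets in polycyclic-by-finite groups *)

Section GroupFoelner.
Variable G : groupType.
Local Open Scope group_scope.
Implicit Types (N H : groupClosed G).

(** The quotient of sizes is at most (c+1)/c.  The list [T] may have repetitions
and extra elements: only an upper bound for the number of products matters. *)
Definition foelner (H : {pred G}) := forall (S : seq G) (c : nat), {subset S <= H} ->
  exists F T : seq G, [/\ uniq F, (0 < size F)%N, {subset F <= H},
    forall f s, f \in F -> s \in S -> f * s \in T & (c * size T <= c.+1 * size F)%N].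

(** The Foelner condition for the right cosets of [N] in [H], in terms of coset
representatives. *)
Definition coset_foelner (N H : {pred G}) := forall (S : seq G) (c : nat),
  {subset S <= H} -> exists R R' : seq G,
  [/\ {subset R <= H}, uniq R /\ {in R &, forall r r', r * r'^-1 \in N -> r = r'},
      (0 < size R)%N,
      forall r s, r \in R -> s \in S -> exists2 r', r' \in R' & r * s * r'^-1 \in N &
      (c * size R' <= c.+1 * size R)%N].

(** Multiply a Foelner set of [N] by coset representatives [R] that are almost
invariant.  A product [f r s] is [f (r s r'^-1) r'] with [r s r'^-1] in [N], so
the set of [N] has to be almost invariant under these finitely many elements. *)
Lemma foelner_extension N H : {subset N <= H} -> foelner N -> coset_foelner N H -> foelner H.
Proof.
(* The factor 3 leaves room for the product of two ratios:
   ((3c+1)/3c)^2 <= (c+1)/c. *)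
move=> NH fN fH S c SH; have [R [R' [RH [uR Rinj] R0 RS szR]]] := fH S (3 * c)%N SH.
pose SN := [seq rs * r'^-1 | rs <- [seq r * s | r <- R, s <- S], r' <- R'].
have [|F [T [uF F0 FN FT szF]]] := fN [seq u <- SN | u \in N] (3 * c)%N.
  by move=> u; rewrite mem_filter => /andP[].
exists [seq f * r | f <- F, r <- R], [seq t * r' | t <- T, r' <- R'].
split.
- apply: allpairs_uniq => // -[f0 r0] [f0' r0'] /= /allpairsP[[f r] /= [fF rR [-> ->]]].
  move=> /allpairsP[[f' r'] /= [fF' rR' [-> ->]]] E.
  have Er : r = r'; last by subst r'; rewrite (mulIg _ _ _ E).
  apply: Rinj => //; have -> : r * r'^-1 = f^-1 * f'.
    by apply: (mulgI f); rewrite mulgA E mulgK mulVKg.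
  by apply: gpredM; rewrite ?gpredV; apply: FN.
- by rewrite size_allpairs muln_gt0 F0.
- move=> _ /allpairsP[[f r] /= [fF rR ->]]; apply: gpredM; [exact/NH/FN|exact: RH].
- move=> _ s /allpairsP[[f r] /= [fF rR ->]] sS.
  have [r' r'R rsr] := RS r s rR sS.
  have -> : f * r * s = f * (r * s * r'^-1) * r' by rewrite !mulgA mulgVK.
  apply: allpairs_f => //; apply: FT => //; rewrite mem_filter rsr.
  by apply: (allpairs_f (fun rs r' => rs * r'^-1)) => //; apply: allpairs_f.
- rewrite !size_allpairs; have := leq_mul szF szR; rewrite mulnACA [X in (_ <= X)%N]mulnACA.
  move: (_ * size R')%N (_ * size R)%N => X Y XY.
  have [->|c0] := posnP c; first by [].
  rewrite -(leq_pmul2l (_ : 0 < 9 * c)%N) ?muln_gt0 //.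
  by apply: leq_trans (_ : (3 * c).+1 * (3 * c).+1 * Y <= _)%N; [lia|nia].
Qed.

(** A finite system of representatives, chosen irredundant, is invariant up to
[N]. *)
Lemma finite_coset_foelner N H (s : seq G) : {subset s <= H} ->
  (forall x, x \in H -> exists2 r, r \in s & x * r^-1 \in N) -> coset_foelner N H.
Proof.
move=> sH cov S c SH.
pose P n := `[< exists R : seq G, [/\ {subset R <= H}, size R = n, uniq R &
  forall x, x \in H -> exists2 r, r \in R & x * r^-1 \in N] >].
have exP : exists n, P n.
  exists (size (undup s)); apply/asboolP; exists (undup s).
  split=> //; [by move=> x; rewrite mem_undup; apply: sH|exact: undup_uniq|].
  by move=> x /cov[r rs xr]; exists r; rewrite ?mem_undup.
have [n /asboolP[R [RH szR uR covR]] minn] := ex_minnP exP.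
have Rmin (R1 R2 : seq G) (r r' : G) :
    R = R1 ++ r :: R2 -> r' \in R1 ++ R2 -> r * r'^-1 \in N -> False.
  move=> DR r'R rr'.
  have: (n <= size (R1 ++ R2))%N.
    apply: minn; apply/asboolP; exists (R1 ++ R2); split=> //.
    - by move=> x xR; apply: RH; rewrite DR mem_cat inE orbCA -mem_cat xR orbT.
    - by move: uR; rewrite DR -cat_rcons -cats1 -catA uniq_catCA cat_uniq => /and3P[].
    move=> x /covR[y]; rewrite DR mem_cat inE orbCA => /orP[/eqP->|] xr.
      by exists r' => //; rewrite -(divgKA r); apply: gpredM.
    by exists y; rewrite ?mem_cat.
  by rewrite -szR DR !size_cat /=; lia.
exists R, R; split=> //.
- split=> // r r' rR r'R rr'; apply: contrapT => /eqP ne.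
  case/splitPr: rR Rmin r'R => R1 R2 Rmin.
  rewrite mem_cat inE eq_sym (negPf ne) /= -mem_cat => r'R; exact: (Rmin R1 R2 r r').
- by have [r] := covR 1 gpred1; case: (R).
- by move=> r x rR xS; apply: covR; apply: gpredM; [apply: RH|apply: SH].
- by move: (size R) => m; lia.
Qed.

(** If some positive power of the generator lies in [N], the quotient is finite;
otherwise intervals of powers of the generator are almost invariant. *)
Lemma cyclic_coset_foelner N H : normal_in N H -> cyclic_quotient N H -> coset_foelner N H.
Proof.
move=> [NH Nn] [g gH gen].
have NJ n u : u \in N -> g ^+ n * u * g ^- n \in N.
  move=> uN; have := Nn u (g ^- n) uN; rewrite conjgE invgK mulgA; apply.
  by rewrite gpredV; apply: gpredXn.
have [[d d0 gd]|inf] := pselect (exists2 d, (0 < d)%N & g ^+ d \in N).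
  apply: (@finite_coset_foelner N H [seq g ^+ j | j <- iota 0 d]).
    by move=> _ /mapP[j _ ->]; apply: gpredXn.
  have modd x n : x * g ^- n \in N ->
      exists2 r, r \in [seq g ^+ j | j <- iota 0 d] & x * r^-1 \in N.
    move=> xn; exists (g ^+ (n %% d)); first by apply: map_f; rewrite mem_iota ltn_mod.
    have -> : x * (g ^+ (n %% d))^-1 = (x * g ^- n) * (g ^+ d ^+ (n %/ d)).
      rewrite -mulgA -expgnA mulnC; congr (_ * _).
      by rewrite {2}(divn_eq n d) expgnDr invgM mulgVK.
    by apply: gpredM => //; apply: gpredXn.
  move=> x /gen[n /orP[xn|xn]].
    by apply: (modd x n); have := NJ n _ xn; rewrite mulVKg.
  (* As g^d lies in N, so does g^(nd), and g^n is g^-(n(d-1)) modulo N. *)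
  apply: (modd x (n * d.-1)%N).
  have xgn : x * g ^+ n \in N.
    by have := Nn _ (g ^+ n) xn (gpredXn _ gH); rewrite conjgE -mulgA mulKg.
  have -> : x * g ^- (n * d.-1) = x * g ^+ n * (g ^+ d ^+ n)^-1.
    rewrite -expgnA -[d in RHS]prednK // mulSn addnC expgnDr (mulnC d.-1).
    by rewrite invgM -!mulgA mulVKg.
  by apply: gpredM => //; rewrite gpredV; apply: gpredXn.
have ginj a b : g ^+ a * (g ^+ b)^-1 \in N -> a = b.
  have key m n : (m < n)%N -> g ^+ m * (g ^+ n)^-1 \in N -> False.
    move=> mn; rewrite gpredFC -expgnFr ?(ltnW mn) // => h; apply: inf.
    by exists (n - m)%N; rewrite ?subn_gt0.
  by case: (ltngtP a b) => // ab; [move/(key _ _ ab)|rewrite gpredFC => /(key _ _ ab)].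
move=> S c SH.
have [A bndA] : exists A, forall s, s \in S -> exists2 n, (n <= A)%N &
    (g ^- n * s \in N) || (g ^+ n * s \in N).
  elim: S SH => [|s S IH] SH; first by exists 0%N.
  have [|A bndA] := IH; first by move=> x xS; apply: SH; rewrite inE xS orbT.
  have [n sn] := gen s (SH s (mem_head _ _)); exists (maxn A n) => x.
  rewrite inE => /orP[/eqP->|/bndA[m mA xm]]; first by exists n; rewrite ?leq_maxr.
  by exists m => //; apply: leq_trans mA (leq_maxl _ _).
(* Elements of S shift exponents by at most A in either direction; starting the
   interval at A keeps all exponents natural. *)
pose m := (2 * A * c).+1.
exists [seq g ^+ (A + j) | j <- iota 0 m], [seq g ^+ j | j <- iota 0 (m + 2 * A)].
split.
- by move=> _ /mapP[j _ ->]; apply: gpredXn.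
- split.
    rewrite map_inj_uniq ?iota_uniq // => i j E; apply/(@addnI A)/ginj.
    by rewrite E mulgV gpred1.
  by move=> _ _ /mapP[i _ ->] /mapP[j _ ->] /ginj ->.
- by rewrite size_map size_iota.
- move=> _ s /mapP[j jm ->] /bndA[n nA sn].
  have jm' : (j < m)%N by move: jm; rewrite mem_iota.
  case/orP: sn => sn.
    exists (g ^+ (A + j + n)); first by apply: map_f; rewrite mem_iota; lia.
    have := NJ (A + j + n)%N _ sn.
    by rewrite expgnDr -[_ * _ * (_ * s)]mulgA mulVKg.
  exists (g ^+ (A + j - n)); first by apply: map_f; rewrite mem_iota; lia.
  have := NJ (A + j - n)%N _ sn.
  by rewrite mulgA -expgnDr subnK //; lia.
- by rewrite !size_map !size_iota /m; nia.
Qed.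

Lemma foelner_polycyclic (P : {pred G}) : polycyclic P -> foelner P.
Proof.
move=> [n [H [H0 HP Hstep]]].
have fH i : (i <= n)%N -> foelner (H i).
  elim: i => [_|i IH lt_in].
    move=> S c SH; exists [:: 1], [:: 1]; split=> //.
    - by move=> x; rewrite inE H0.
    - by move=> f s; rewrite !inE => /eqP-> /SH; rewrite H0 => /eqP->; rewrite mulg1.
  have [Hn Hc] := Hstep i lt_in.
  by apply: (foelner_extension Hn.1 (IH (ltnW lt_in))); apply: cyclic_coset_foelner.
move=> S c SP; have [|F [T [uF F0 FH FT sz]]] := fH n (leqnn n) S c.
  by move=> x /SP; rewrite HP.
by exists F, T; split=> // x /FH; rewrite HP.
Qed.

(** The full group, named so that it carries a subgroup structure. *)
Definition whole : {pred G} := predT.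
HB.instance Definition _ := isMulClosed.Build G whole (fun _ _ _ _ => isT).
HB.instance Definition _ := isMul1Closed.Build G whole isT.
HB.instance Definition _ := isInvClosed.Build G whole (fun _ _ => isT).

Lemma foelner_polycyclic_by_finite : polycyclic_by_finite G -> foelner whole.
Proof.
move=> [N [Npc Nn [s cov]]].
apply: (@foelner_extension N whole) => //; first exact: foelner_polycyclic.
apply: (@finite_coset_foelner N whole [seq t^-1 | t <- s]) => // x _.
have [t ts tx] := cov x^-1.
exists t^-1; first exact: map_f.
by rewrite invgK -(gpredV N) invgM.
Qed.
End GroupFoelner.

(** * Expansion of subspaces under a free pair *)

(** Gaussian elimination of one unknown by one equation. *)
Lemma underdetermined (E : unitRingType) (EF : skew_field E) (s t : nat)
    (A : 'M[E]_(s, t)) : (s < t)%N -> exists2 w : 'cV[E]_t, w != 0 & A *m w = 0.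
Proof.
elim: s t A => [|s IH] [//|t] A st.
  exists (delta_mx ord0 ord0); last by apply/matrixP => -[].
  by apply/eqP => /matrixP/(_ ord0 ord0)/eqP; rewrite !mxE !eqxx oner_eq0.
have [[j aj]|a0] := pselect (exists j, A ord0 j != 0); last first.
  have [|w w0 Aw] := IH _ (row' ord0 A); first exact: ltnW.
  exists w => //; apply/matrixP => i k; rewrite !mxE.
  case: (unliftP ord0 i) => [i' ->|->].
    move/matrixP/(_ i' k): Aw; rewrite !mxE => Aw; rewrite -[RHS]Aw.
    by apply: eq_bigr => l _; rewrite mxE.
  rewrite big1 // => l _; suff -> : A ord0 l = 0 by rewrite mul0r.
  by apply: contrapT => /eqP Al; apply: a0; exists l.
pose A' := \matrix_(i, k) (A (lift ord0 i) (lift j k) -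
   A (lift ord0 i) j * (A ord0 j)^-1 * A ord0 (lift j k)).
have [//|w w0 Aw] := IH t A'.
pose wj := - ((A ord0 j)^-1 * \sum_k A ord0 (lift j k) * w k ord0).
pose W : 'cV[E]_t.+1 := \col_k if unlift j k is Some k' then w k' ord0 else wj.
have Wl k : W (lift j k) ord0 = w k ord0 by rewrite mxE liftK.
have Wj : W j ord0 = wj by rewrite mxE unlift_none.
exists W.
  apply: contra_neq w0 => W0; apply/matrixP => k l; rewrite ord1 -Wl W0 !mxE //.
apply/matrixP => i l; rewrite !ord1 !mxE (bigD1_ord j) //= Wj.
under eq_bigr => k _ do rewrite Wl.
case: (unliftP ord0 i) => [i' ->|->]; last first.
  by rewrite /wj mulrN mulVKr ?EF // addNr.
move/matrixP/(_ i' ord0): Aw; rewrite !mxE => Aw; rewrite -[RHS]Aw.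
rewrite /wj mulrN mulrA mulr_sumr -sumrN -big_split /=; apply: eq_bigr => k _.
by rewrite !mxE mulrBl addrC !mulrA.
Qed.

Section SingularFactorization.
Variables (R Q : nzRingType) (phi : {rmorphism R -> Q}).
Hypothesis singular_factors : forall n (A : 'M[R]_n.+1) (q : 'rV[Q]_n.+1),
  q != 0 -> q *m map_mx phi A = 0 ->
  exists (B : 'M[R]_(n.+1, n)) (C : 'M[R]_(n, n.+1)), A = B *m C.

(** The columns of [C] are added one at a time.  If the previous columns factor
through [B], and [B] has only one column less than [C] has rows, then [B] with the
new column is a square matrix killed by [q], so it factors through fewer columns.
The first factor might not be killed by [q]; in that case [q]
times that factor kills the second one, and induction on the number of rows
applies to it. *)
Lemma kernel_factors r b (C : 'M[R]_(r, b)) (q : 'rV[Q]_r) :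
  q != 0 -> q *m map_mx phi C = 0 ->
  exists s (B : 'M[R]_(r, s)) (D : 'M[R]_(s, b)),
    [/\ (s < r)%N, C = B *m D & q *m map_mx phi B = 0].
Proof.
have [n] := ubnP r; elim: n r b C q => // n IHn r b C q rn q0.
elim: b C => [|b IHb] C qC.
  have r0 : (0 < r)%N by case: (r) q q0 {C qC rn} => // q; rewrite (thinmx0 q) eqxx.
  exists 0%N, 0, 0; split=> //; last by rewrite map_mx0 mulmx0.
  by apply/matrixP => i [].
move: C qC; rewrite -[b.+1]/(1 + b)%N => C qC.
pose c := lsubmx C; pose C1 := rsubmx C.
have DC : C = row_mx c C1 by rewrite hsubmxK.
move: qC; rewrite DC map_row_mx mul_mx_row -row_mx0 => /eq_row_mx[qc qC1].
have [s [B [D [sr C1E qB]]]] := IHb C1 qC1.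
pose M := row_mx c B.
pose T : 'M[R]_(1 + s, 1 + b) := block_mx 1%:M 0 0 D.
have CM : row_mx c C1 = M *m T.
  by rewrite mul_row_block !mulmx1 !mulmx0 addr0 add0r -C1E.
have qM : q *m map_mx phi M = 0 by rewrite map_row_mx mul_mx_row qc qB row_mx0.
case: (ltngtP s.+1 r) sr => // [sr _|rs _].
  by exists (1 + s)%N, M, T.
subst r; have [B3 [C3 M3]] := singular_factors q0 (qM : q *m map_mx phi (M : 'M_s.+1) = 0).
have [qB3|qB3] := eqVneq (q *m map_mx phi B3) 0.
  exists s, B3, (C3 *m (T : 'M_(s.+1, 1 + b))); split=> //.
  by rewrite mulmxA -M3 CM.
have [||s4 [B4 [D4 [s4s C3E qB4]]]] := IHn _ _ C3 _ _ qB3; first exact: rn.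
  by rewrite -mulmxA -map_mxM -M3.
exists s4, (B3 *m B4), (D4 *m (T : 'M_(s.+1, 1 + b))); split=> //.
- exact: leqW.
- by rewrite -mulmxA (mulmxA B4) -C3E mulmxA -M3 CM.
- by rewrite map_mxM mulmxA.
Qed.
End SingularFactorization.

Section FoxRule.
Variables (R : nzRingType) (D e : {additive R -> R}).

(** Fox's product rule for a derivation along an augmentation [e]. *)
Definition fox_rule (f g : R) := D (f * g) = f * D g + D f * e g.

Lemma fox_rule0r f : fox_rule f 0.
Proof. by rewrite /fox_rule mulr0 !raddf0 !mulr0 addr0. Qed.

Lemma fox_rule0l g : fox_rule 0 g.
Proof. by rewrite /fox_rule mul0r !raddf0 !mul0r addr0. Qed.

Lemma fox_ruleDr f a b : fox_rule f a -> fox_rule f b -> fox_rule f (a + b).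
Proof.
by rewrite /fox_rule mulrDr !raddfD !mulrDr => -> ->; rewrite addrACA.
Qed.

Lemma fox_ruleDl g a b : fox_rule a g -> fox_rule b g -> fox_rule (a + b) g.
Proof.
by rewrite /fox_rule mulrDl !raddfD !mulrDl => -> ->; rewrite addrACA.
Qed.
End FoxRule.

Section FreeFieldObstruction.
Variables (E : unitRingType) (EF : skew_field E) (R Q : nzRingType).
Variables (cst : {rmorphism E -> R}) (eps : {rmorphism R -> E}).
Variables (x y : R) (dx dy : {additive R -> R}).
Hypothesis eps_cst : forall e, eps (cst e) = e.
Hypothesis comm_x : forall e, x * cst e = cst e * x.
Hypothesis comm_y : forall e, y * cst e = cst e * y.
Hypothesis dx_rule : forall f g, fox_rule dx (cst \o eps) f g.
Hypothesis dy_rule : forall f g, fox_rule dy (cst \o eps) f g.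
Hypothesis dx_cst : forall e, dx (cst e) = 0.
Hypothesis dy_cst : forall e, dy (cst e) = 0.
Hypotheses (dx_x : dx x = 1) (dx_y : dx y = 0) (dy_x : dy x = 0) (dy_y : dy y = 1).

Variable phi : {rmorphism R -> Q}.
Hypothesis singular_factors : forall n (A : 'M[R]_n.+1) (q : 'rV[Q]_n.+1),
  q != 0 -> q *m map_mx phi A = 0 ->
  exists (B : 'M[R]_(n.+1, n)) (C : 'M[R]_(n, n.+1)), A = B *m C.

Local Notation ev := (phi \o cst).

Lemma fox_last (d : {additive R -> R}) e z : (forall f g, fox_rule d (cst \o eps) f g) ->
  (forall e, d (cst e) = 0) -> (forall e, z * cst e = cst e * z) ->
  d (cst e * z) = cst e * d z.
Proof. by move=> dr d0 zc; rewrite dr /= d0 mul0r addr0. Qed.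

(** The free ring enters only through its augmentation [eps] and the Fox derivatives
[dx] and [dy] along two of its generators.  The columns of
[L = (A - Jx | B - Jy)] express that [px] and [py] lie in the span of [u], and
[u L = 0].  If [N <= 2h], then [L = B1 D] where [D] has fewer than [2h] rows and
[u B1 = 0].  Hence some constant column [w <> 0] makes all augmentations of [D w]
vanish, and then a Fox derivative of [L w] is [B1] times that of [D w].  The
derivatives of [L w] by [x] and [y] are [- J w1] and [- J w2], so [u] kills both,
which means [p w1 = p w2 = 0]. *)
Lemma free_pair_doubles (h N : nat) (p : 'rV[Q]_h) (u : 'rV[Q]_N)
    (J A B : 'M[E]_(N, h)) :
  (0 < h)%N ->
  (forall w : 'cV[E]_h, p *m map_mx ev w = 0 -> w = 0) ->
  p = u *m map_mx ev J ->
  p *m (phi x)%:M = u *m map_mx ev A ->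
  p *m (phi y)%:M = u *m map_mx ev B ->
  (h + h < N)%N.
Proof.
move=> h0 pfree pJ pA pB; rewrite ltnNge; apply/negP => Nh.
pose c m n (M : 'M[E]_(m, n)) : 'M[R]_(m, n) := map_mx cst M.
have phic m n (M : 'M[E]_(m, n)) : map_mx phi (c m n M) = map_mx ev M.
  by apply/matrixP => i j; rewrite !mxE.
pose L := row_mx (c _ _ A - c _ _ J *m x%:M) (c _ _ B - c _ _ J *m y%:M).
have uL : u *m map_mx phi L = 0.
  rewrite map_row_mx mul_mx_row !map_mxB !map_mxM !phic !map_scalar_mx.
  by rewrite !mulmxBr !mulmxA -pJ -pA -pB !subrr row_mx0.
have u0 : u != 0.
  apply/eqP => u0; have p0 : p = 0 by rewrite pJ u0 mul0mx.
  have := pfree (const_mx 1); rewrite p0 mul0mx => /(_ erefl).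
  by move/matrixP/(_ (Ordinal h0) ord0)/eqP; rewrite !mxE oner_eq0.
have [s [B1 [D [sN LE uB]]]] := kernel_factors singular_factors u0 uL.
have [w w0 Dw] := underdetermined EF (map_mx eps D) (leq_trans sN Nh).
pose V := D *m c _ _ w.
have V1 i : eps (V i ord0) = 0.
  move/matrixP/(_ i ord0): Dw; rewrite !mxE => Dw; rewrite -[RHS]Dw.
  rewrite rmorph_sum; apply: eq_bigr => j _; rewrite !mxE.
  by rewrite rmorphM /= eps_cst.
have foxL (d : {additive R -> R}) : (forall f g, fox_rule d (cst \o eps) f g) ->
    map_mx d (L *m c _ _ w) = B1 *m map_mx d V.
  move=> dr; rewrite LE -mulmxA -/V; apply/matrixP => i j; rewrite !mxE ord1.
  rewrite raddf_sum; apply: eq_bigr => k _.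
  by rewrite dr /= V1 rmorph0 mulr0 addr0; congr (_ * _); rewrite [RHS]mxE.
pose w1 : 'cV[E]_h := usubmx w; pose w2 : 'cV[E]_h := dsubmx w.
have wE : w = col_mx w1 w2 by rewrite vsubmxK.
have Lw : L *m c _ _ w = c _ _ (A *m w1 + B *m w2)
    - c _ _ (J *m w1) *m x%:M - c _ _ (J *m w2) *m y%:M.
  have cl z (m : 'cV[E]_h) : (forall e, z * cst e = cst e * z) ->
      z%:M *m c _ _ m = c _ _ m *m z%:M.
    move=> zc; apply/matrixP => i j; rewrite mul_scalar_mx !mxE ord1 big_ord1 !mxE.
    by rewrite eqxx zc.
  rewrite wE /c map_col_mx mul_row_col -!/(c _ _ _).
  rewrite !mulmxBl -!mulmxA !cl // !mulmxA /c -!map_mxM map_mxD.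
  by rewrite addrACA addrA.
have uniq0 (v : 'cV[E]_h) (d : {additive R -> R}) :
    (forall f g, fox_rule d (cst \o eps) f g) ->
    map_mx d (L *m c _ _ w) = - c _ _ (J *m v) -> v = 0.
  move=> dr; rewrite (foxL d dr) => /(congr1 (fun M => u *m map_mx phi M)).
  rewrite map_mxM mulmxA uB mul0mx map_mxN mulmxN phic => /eqP.
  rewrite eq_sym oppr_eq0 => /eqP uJv; apply: pfree; rewrite pJ -mulmxA.
  by rewrite -[RHS]uJv (map_mxM ev).
have foxLw (d : {additive R -> R}) a b : (forall f g, fox_rule d (cst \o eps) f g) ->
    (forall e, d (cst e) = 0) -> d x = a -> d y = b ->
    map_mx d (L *m c _ _ w) = - c _ _ (J *m w1) *m a%:M - c _ _ (J *m w2) *m b%:M.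
  move=> dr d0 da db; rewrite Lw; apply/matrixP => i j; rewrite !mxE ord1.
  rewrite !big_ord1 !mxE !eqxx !mulr1n !raddfB d0.
  by rewrite (fox_last _ dr d0 comm_x) (fox_last _ dr d0 comm_y) da db sub0r mulNr.
have w10 : w1 = 0.
  apply: (uniq0 _ dx dx_rule); rewrite (foxLw dx 1 0) // mulmx1.
  by rewrite raddf0 mulmx0 subr0.
have w20 : w2 = 0.
  apply: (uniq0 _ dy dy_rule); rewrite (foxLw dy 0 1) // mulmx1.
  by rewrite raddf0 mulmx0 sub0r.
by move: w0; rewrite wE w10 w20 col_mx0 eqxx.
Qed.

End FreeFieldObstruction.

Section FoxDerivative.
Variables (E : nzRingType) (X : choiceType).
Local Notation R := {malg E[{fmonom X}]}.
Local Notation cst := (@mkmalgU {fmonom X} E mone).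

Definition letter (x : X) : R := << 1 *g fmu x >>.

(** A word without its last letter, provided that this letter is [x]. *)
Definition cut_last (x : X) (w : {fmonom X}) : option {fmonom X} :=
  if rev w is y :: s then (if y == x then Some (FMonom (rev s)) else None)
  else None.

(** The Fox derivative by [x]: it keeps the monomials ending in [x] and strips
that letter. *)
Definition fox (x : X) : R -> R :=
  mmap cst (fun w => if cut_last x w is Some w' then << 1 *g w' >> else 0).

Lemma malg_mulUU c1 c2 (k1 k2 : {fmonom X}) :
  << c1 *g k1 >> * << c2 *g k2 >> = << c1 * c2 *g mmul k1 k2 >> :> R.
Proof. exact: fgmulUU. Qed.

Lemma foxU x c w :
  fox x << c *g w >> = if cut_last x w is Some w' then << c *g w' >> else 0.
Proof.
rewrite /fox mmapU; case: cut_last => [w'|]; last exact: mulr0.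
by rewrite (malg_mulUU c 1) mulr1 mul1m.
Qed.

Lemma cut_last1 x : cut_last x mone = None.
Proof. by rewrite /cut_last fm1. Qed.

Lemma cut_lastM x u v : v != mone ->
  cut_last x (mmul u v) = omap (mmul u) (cut_last x v).
Proof.
case: v => v; case/lastP: v => [|v y] nv.
  by move: nv; rewrite -fmoneE eqxx.
have -> : mmul u (FMonom (rcons v y)) = FMonom (rcons (u ++ v) y).
  by rewrite rcons_cat; exact: fmmulE.
rewrite /cut_last /= !rev_rcons; case: eqP => //= _; rewrite !revK.
by congr Some; symmetry; exact: fmmulE.
Qed.

HB.instance Definition _ x := GRing.Additive.on (fox x).

Definition augmentation : R -> R := cst \o mcoeff mone.
HB.instance Definition _ := GRing.Additive.on augmentation.

(** By biadditivity it is enough to multiply two monomials, and then only the last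
letter of the product matters: it is the last letter of the right factor unless
that factor is the empty word. *)
Lemma foxM x (f g : R) : fox_rule (fox x) augmentation f g.
Proof.
rewrite [g]monalgE; apply: (big_ind (fox_rule _ _ f)).
- exact: fox_rule0r.
- exact: fox_ruleDr.
move=> v _; move: (g@_v) => d {g}.
rewrite [f]monalgE; apply: (big_ind (fun f => fox_rule _ _ f _)).
- exact: fox_rule0l.
- by move=> a b; apply: fox_ruleDl.
move=> u _; move: (f@_u) => c {f}.
rewrite /fox_rule /= malg_mulUU (foxU x (c * d)) (foxU x c) (foxU x d).
rewrite /augmentation /= mcoeffU.
have [->|nv] := eqVneq v mone.
  rewrite cut_last1 mulm1 mulr1n (mulr0 << c *g u >>) add0r.
  case: cut_last => [w|]; last by rewrite (mul0r (cst d)).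
  by rewrite malg_mulUU mulm1.
rewrite (cut_lastM _ _ nv) mulr0n monalgU0.
case: cut_last => [w|] /=; last by rewrite !(mulr0 _) addr0.
by rewrite mulr0 addr0 malg_mulUU.
Qed.

Lemma fox_cst x c : fox x (cst c) = 0.
Proof. by rewrite foxU cut_last1. Qed.

Lemma fox_letter x y : fox x (letter y) = (x == y)%:R.
Proof.
rewrite foxU fmuE /cut_last /= eq_sym; case: eqP => //= _.
by rewrite -fmoneE.
Qed.

Lemma letter_cst x c : letter x * cst c = cst c * letter x.
Proof. by rewrite (malg_mulUU 1) (malg_mulUU c) mulm1 mul1m mul1r mulr1. Qed.

End FoxDerivative.

(** * Minimal deficient subspaces *)

Section MinimalSpaces.
Variables (Q : unitRingType) (QF : skew_field Q) (K : divringClosed Q).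
Hypothesis Kcentral : forall c v, c \in K -> c * v = v * c.
Variables x y : Q.

(** For V the span of [s], this bounds V + Vx + Vy by the span of [t].  The field of
scalars is a parameter because both K and Z will be used. *)
Definition moves_into (L : divringClosed Q) (s t : seq Q) :=
  forall v, v \in s -> [/\ lspan L t v, lspan L t (v * x) & lspan L t (v * y)].

(** The elements of [s] form a basis of a space V for which V + Vx + Vy has less
than twice the dimension of V: the growth that is excluded in a free field. *)
Definition deficient s := [/\ indep K s, (0 < size s)%N &
  exists2 t, (size t < 2 * size s)%N & moves_into K s t].

Definition minimal_deficient s :=
  deficient s /\ forall s', deficient s' -> (size s <= size s')%N.

Lemma linear_mulr (L : divringClosed Q) z : linear_over L ( *%R^~ z).
Proof. by split=> [u v|c v _]; rewrite ?mulrDl ?mulrA. Qed.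

Lemma linear_mull q : linear_over K ( *%R q).
Proof.
split=> [u v|c v cK]; first exact: mulrDr.
by rewrite mulrA -(Kcentral q cK) -mulrA.
Qed.

Lemma moves_into_span (L : divringClosed Q) s t v : moves_into L s t -> lspan L s v ->
  [/\ lspan L t v, lspan L t (v * x) & lspan L t (v * y)].
Proof.
move=> st; apply: (span_ind (P := fun v =>
  [/\ lspan L t v, lspan L t (v * x) & lspan L t (v * y)])) => //.
- by rewrite !mul0r; split; apply: span0.
- by move=> u w [? ? ?] [? ? ?]; rewrite !mulrDl; split; apply: spanD.
- by move=> c w cL [? ? ?]; rewrite -!mulrA; split; apply: spanZ.
Qed.

Lemma indep_map f s : linear_over K f -> (forall v, lspan K s v -> f v = 0 -> v = 0) ->
  indep K s -> indep K (map f s).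
Proof.
move=> fL; elim: s => //= a s IH f0 [is_ na]; split.
  by apply: IH => // v sv; apply: f0; exists 0; rewrite ?rpred0 // mul0r subr0.
move=> /(span_mapP fL)[u su fau]; apply: na.
suff /eqP : a - u = 0 by rewrite subr_eq0 => /eqP->.
apply: f0; last by rewrite (linear_overB _ _ fL) fau subrr.
exists 1; first exact: rpred1.
by rewrite mul1r addrAC subrr sub0r; apply: spanN.
Qed.

(** The kernel and the image of [f] on V inherit the relation to right
multiplication by [x] and [y], and both dim V and the size of [t] are distributed
over them.  If both were nonzero, one of them would be a smaller deficient space. *)
Lemma minimal_map_zero f s v0 : minimal_deficient s -> linear_over K f ->
  (forall v, f (v * x) = f v * x) -> (forall v, f (v * y) = f v * y) ->
  lspan K s v0 -> v0 != 0 -> f v0 = 0 -> forall v, lspan K s v -> f v = 0.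
Proof.
move=> [[is_ s0 [t szt st]] smin] fL fx fy sv0 v00 fv0.
have [s1 [s2 [[szs sub1] sp s2f kers [is1 is2]]]] := split_along QF s [::] fL.
have [t1 [t2 [[szt12 _] tp t2f kert _]]] := split_along QF t [::] fL.
have s2s v : v \in s2 -> lspan K s v.
  by move=> vs; apply/sp; apply: span_mem; rewrite mem_cat vs orbT.
have {}is1 : indep K (map f s1) by have := is1 I; rewrite cats0.
have d2 : (0 < size s2)%N -> (size s2 < size s)%N -> (2 * size s2 <= size t2)%N.
  move=> s20 s2s'; rewrite leqNgt; apply/negP => lt; have := smin s2.
  rewrite leqNgt s2s' => /(_ _)/negP; apply=> //; split; [exact: is2|by []|].
  exists t2 => // v vs2; have [tv tvx tvy] := moves_into_span st (s2s v vs2).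
  have fv : f v = 0 := s2f v vs2.
  by split; apply: kert => //=; rewrite ?fx ?fy fv ?mul0r.
have d1 : (0 < size s1)%N -> (size s1 < size s)%N -> (2 * size s1 <= size t1)%N.
  move=> s10 s1s'; rewrite leqNgt; apply/negP => lt; have := smin (map f s1).
  rewrite leqNgt size_map s1s' => /(_ _)/negP; apply=> //; split=> //; rewrite ?size_map //.
  exists (map f t1); first by rewrite size_map.
  have ft u : lspan K t u -> lspan K (map f t1) (f u).
    move=> /tp /(span_map fL); apply: span_trans => w; rewrite map_cat mem_cat.
    by case/orP=> [|/mapP[z /t2f /= fz ->]]; [exact: span_mem|rewrite fz; exact: span0].
  move=> _ /mapP[v /sub1 vs ->]; have [tv tvx tvy] := st v vs.
  by rewrite -fx -fy; split; apply: ft.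
case: (posnP (size s1)) => [/size0nil s1E v|s10].
  rewrite s1E /= in sp; move/sp; apply: (span_ind (P := fun v => f v = 0)).
  - exact: (linear_over0 fL).
  - by move=> u w fu fw; rewrite fL.1 fu fw addr0.
  - by move=> c w cK fw; rewrite fL.2 // fw mulr0.
  - exact: s2f.
case: (posnP (size s2)) => [/size0nil s2E|s20].
  have : lspan K s2 v0 by apply: kers.
  by rewrite s2E /= => /eqP; rewrite (negPf v00).
have lt1 : (size s1 < size s)%N by rewrite -szs -[X in (X < _)%N]addn0 ltn_add2l.
have lt2 : (size s2 < size s)%N by rewrite -szs -[X in (X < _)%N]add0n ltn_add2r.
move: szt; rewrite -szs -szt12 ltnNge mulnDr leq_add //; [exact: d1|exact: d2].
Qed.

Lemma minimal_mull s q : q != 0 -> minimal_deficient s ->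
  minimal_deficient (map ( *%R q) s).
Proof.
move=> q0 [[is_ s0 [t szt st]] smin]; split; last by rewrite size_map.
split; rewrite ?size_map //.
  apply: indep_map => //; first exact: linear_mull.
  by move=> v _ qv; rewrite -(mulKr (QF q0) v) qv mulr0.
exists (map ( *%R q) t); first by rewrite size_map.
move=> _ /mapP[v /st[tv tvx tvy] ->]; rewrite -!mulrA.
by split; apply: span_map => //; apply: linear_mull.
Qed.

(** Left multiplication commutes with right multiplication by [x] and [y], so a
minimal space can be translated to contain 1. *)
Lemma minimal_with_one : (exists s, deficient s) ->
  exists2 s, minimal_deficient s & lspan K s 1.
Proof.
move=> [s0 ds0].
pose P n := `[< exists2 s, deficient s & size s = n >].
have exP : exists n, P n by exists (size s0); apply/asboolP; exists s0.
have [n /asboolP[s ds szs] minn] := ex_minnP exP.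
have ms : minimal_deficient s.
  by split=> // s' ds'; rewrite szs; apply: minn; apply/asboolP; exists s'.
have [is_ s_gt0 _] := ds; case: s ms is_ s_gt0 {ds szs} => // a s ms [_ na] _.
have a0 : a != 0 by apply/eqP => a0; apply: na; rewrite a0; apply: span0.
exists (map ( *%R a^-1) (a :: s)); first by apply: minimal_mull; rewrite ?invr_eq0.
by apply: span_mem; rewrite /= mulVr ?QF // mem_head.
Qed.

(** The map [v |-> v e - e v] commutes with right multiplication by [x] and [y] and
kills 1. *)
Lemma minimal_centralizes s e : minimal_deficient s -> lspan K s 1 ->
  x * e = e * x -> y * e = e * y -> forall v, lspan K s v -> v * e = e * v.
Proof.
move=> ms s1 xe ye v sv; apply/eqP; rewrite -subr_eq0; apply/eqP.
apply: (@minimal_map_zero (fun v => v * e - e * v) s 1) sv => //.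
- split=> [u w|c w cK]; first by rewrite mulrDl mulrDr opprD addrACA.
  by rewrite mulrBr !mulrA (Kcentral e cK).
- by move=> u; rewrite mulrBl -!mulrA xe.
- by move=> u; rewrite mulrBl -!mulrA ye.
- exact: oner_neq0.
- by rewrite mul1r mulr1 subrr.
Qed.

(** The multiples by [zs] are added one after another.  Adding [V z] to the span
of [al] increases its dimension by the codimension in V of the space V' of those v
with [v z] in the span of [al].  A proper subspace V' is not deficient, so at least
2 dim V' of the vectors spanning V + Vx + Vy are lost when they are multiplied by
[z], and [be] grows at most twice as much as [al]. *)
Lemma minimal_multiples s zs : minimal_deficient s ->
  (forall z, z \in zs -> z * x = x * z /\ z * y = y * z) ->
  exists al be, [/\ indep K al,
    forall v z, v \in s -> z \in zs -> lspan K al (v * z),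
    forall v, v \in al -> lspan K [seq v * z | v <- s, z <- zs] v,
    moves_into K al be & (size be <= 2 * size al)%N].
Proof.
move=> [[is_ s0 [t szt st]] smin]; elim: zs => [_|z zs IH zc].
  by exists [::], [::]; split.
have [|al [be [ial alP alS albe szal]]] := IH.
  by move=> w ws; apply: zc; rewrite inE ws orbT.
have [zx zy] := zc z (mem_head _ _).
have alS' v : v \in al -> lspan K [seq v * z | v <- s, z <- z :: zs] v.
  move=> /alS; apply: span_sub => _ /allpairsP[[u w] [us ws ->]].
  apply: (allpairs_f (fun v z => v * z)); first exact: us.
  by rewrite inE; apply/orP; right; exact: ws.
have zL := linear_mulr K z.
have [s1 [s2 [[szs sub1] sp s2z kers [is1 is2]]]] := split_along QF s al zL.
have [t1 [t2 [[szt12 _] tp t2z kert _]]] := split_along QF t be zL.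
have s2s v : v \in s2 -> lspan K s v.
  by move=> vs; apply/sp; apply: span_mem; rewrite mem_cat vs orbT.
case: (posnP (size s1)) => [/size0nil s1E|s10].
  exists al, be; split=> // v w vs; rewrite inE => /orP[/eqP->|]; last exact: alP.
  have : lspan K s2 v by rewrite s1E /= in sp; apply/sp; apply: span_mem.
  move=> /(span_map zL); apply: span_trans => _ /mapP[u us2 ->]; exact: s2z.
have d2 : (2 * size s2 <= size t2)%N.
  case: (posnP (size s2)) => [->//|s20].
  rewrite leqNgt; apply/negP => lt; have := smin s2; rewrite leqNgt.
  have -> : (size s2 < size s)%N by rewrite -szs; lia.
  move=> /(_ _)/negP; apply=> //; split; [exact: is2|by []|].
  exists t2 => // v vs2; have [tv tvx tvy] := moves_into_span st (s2s v vs2).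
  have [bv bvx bvy] := moves_into_span albe (s2z v vs2).
  by split; apply: kert => //=; rewrite -mulrA -?zx -?zy mulrA.
exists (map ( *%R^~ z) s1 ++ al), (map ( *%R^~ z) t1 ++ be); split.
- exact: is1.
- move=> v w vs; rewrite inE => /orP[/eqP->|ws]; last first.
    by apply: span_sub (alP v w vs ws) => u; rewrite mem_cat orbC => ->.
  have : lspan K (s1 ++ s2) v by apply/sp; apply: span_mem.
  move=> /(span_map zL); apply: span_trans => u; rewrite map_cat mem_cat.
  case/orP=> [us|/mapP[u' u's2 ->]]; first by apply: span_mem; rewrite mem_cat us.
  by apply: span_sub (s2z u' u's2) => w' w'al; rewrite mem_cat w'al orbT.
- move=> v; rewrite mem_cat => /orP[/mapP[u us1 ->]|]; last exact: alS'.
  apply: span_mem; apply: (allpairs_f (fun v z => v * z)); last exact: mem_head.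
  exact: sub1.
- have tz u : lspan K t u -> lspan K (map ( *%R^~ z) t1 ++ be) (u * z).
    move=> /tp /(span_map zL); apply: span_trans => w; rewrite map_cat mem_cat.
    case/orP=> [ws|/mapP[u' u't2 ->]]; first by apply: span_mem; rewrite mem_cat ws.
    by apply: span_sub (t2z u' u't2) => w' w'be; rewrite mem_cat w'be orbT.
  move=> v; rewrite mem_cat => /orP[/mapP[u us1 ->]|vl].
    have [tv tvx tvy] := st u (sub1 u us1).
    by rewrite -!mulrA zx zy !mulrA; split; apply: tz.
  have [bv bvx bvy] := albe v vl.
  by split; [move: bv|move: bvx|move: bvy]; apply: span_sub => w wb; rewrite mem_cat wb orbT.
- rewrite !size_cat !size_map mulnDr leq_add // -(leq_add2r (2 * size s2)) -mulnDr szs.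
  by apply: leq_trans (ltnW szt); rewrite -szt12 leq_add2l.
Qed.
End MinimalSpaces.

(** * From the base field to a larger commutative field *)

Section ExtensionOfScalars.
Variables (Q : unitRingType) (QF : skew_field Q) (K Z : divringClosed Q).
Hypothesis KZ : {subset K <= Z}.
Hypothesis Zcomm : {in Z &, forall a b : Q, a * b = b * a}.
Variables x y : Q.
Hypothesis Zxy : forall z, z \in Z -> z * x = x * z /\ z * y = y * z.

Lemma span_products (s t : seq Q) u w : lspan K s u -> w \in t ->
  lspan K [seq m * v | v <- t, m <- s] (u * w).
Proof.
move=> /(span_map (linear_mulr K w)) + wt; apply: span_sub => _ /mapP[m ms ->].
by apply: (allpairs_f (fun v m => m * v)).
Qed.

Lemma finite_coefficients (p s : seq Q) : (forall v, v \in s -> lspan Z p v) ->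
  exists2 a : seq Q, {subset a <= Z} & forall v, v \in s ->
    exists2 c : 'I_(size p) -> Q, (forall i, c i \in a) & v = \sum_i c i * p`_i.
Proof.
elim: s => [|v s IH] ps; first by exists [::].
have [|a aZ aP] := IH; first by move=> w ws; apply: ps; rewrite inE ws orbT.
have [c cZ Dv] := span_coef (ps v (mem_head _ _)).
exists (codom c ++ a).
  by move=> z; rewrite mem_cat => /orP[/codomP[i ->]|/aZ].
move=> w; rewrite inE => /orP[/eqP->|/aP[d da ->]].
  by exists c => // i; rewrite mem_cat codom_f.
by exists d => // i; rewrite mem_cat da orbT.
Qed.

(** Let D be an almost invariant K-subspace of Z.  If [ph] had more than twice as
many elements as [p], then the dimension of VD + VDx + VDy would be at least
[size ph * size D], whereas VD has dimension at most [size p * size D'] with [D']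
hardly longer than [D], because V has coefficients in a finite set over [p]
([finite_coefficients]).  This contradicts [minimal_multiples]. *)
Lemma deficient_over_extension s : minimal_deficient K x y s ->
  (forall v z, v \in s -> z \in Z -> v * z = z * v) ->
  exists p ph : seq Q, [/\ indep Z p /\ (0 < size p)%N, {subset p <= s},
    {subset ph <= s ++ map ( *%R^~ x) s ++ map ( *%R^~ y) s},
    moves_into x y Z p ph & (size ph <= 2 * size p)%N].
Proof.
move=> ms sZ; have [[is_ s0 _] _] := ms.
have [p [ip _ sub_ps sp]] := basis_of_list QF Z s.
set w0 := s ++ _.
have [ph [iph _ sub_ph sph]] := basis_of_list QF Z w0.
have w0ph v : v \in w0 -> lspan Z ph v by move=> vw; apply/sph; apply: span_mem.
have pph : moves_into x y Z p ph.
  move=> v /sub_ps vs.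
  by split; apply: w0ph; rewrite !mem_cat ?vs // (map_f ( *%R^~ _)) ?orbT.
have p_gt0 : (0 < size p)%N.
  case: (s) is_ s0 sp => // v s' [_ nv] _ sp; case: (p) sp => // sp.
  have /sp /= v0 : lspan Z (v :: s') v by apply: span_mem; apply: mem_head.
  by case: nv; rewrite v0; apply: span0.
exists p, ph; split=> //; rewrite leqNgt; apply/negP => big.
have [|a aZ aP] := @finite_coefficients p s.
  by move=> v vs; apply/sp; apply: span_mem.
(* With h = 2 size p, the ratio (h+2)/(h+1) is below (h+1)/h, so it cannot make up
   for the extra vector in ph. *)
have [D [D' [iD [DZ D'Z] D0 DD' szD]]] :=
  commutative_foelner QF KZ Zcomm (2 * size p).+1 aZ.
have [z zD|al [be [ial alP alS albe szal]]] := minimal_multiples QF (zs := D) ms.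
  by apply: Zxy; apply: DZ.
have lower : (size ph * size D <= size be)%N.
  rewrite -(size_allpairs (fun v b => b * v)); apply: (steinitz QF (K := K)).
    exact: (tower_indep QF KZ iph iD DZ).
  move=> _ /allpairsP[[v b] /= [/sub_ph vw bD ->]].
  have [bx by_] := Zxy (DZ b bD).
  have al_v u : u \in s ->
      [/\ lspan K be (b * u), lspan K be (b * u * x) & lspan K be (b * u * y)].
    move=> us; rewrite -(sZ u b us (DZ b bD)).
    by apply: (moves_into_span albe); apply: alP.
  move: vw; rewrite !mem_cat => /or3P[|/mapP[u us ->]|/mapP[u us ->]].
  - by move=> /al_v[].
  - by rewrite mulrA; have [] := al_v u us.
  - by rewrite mulrA; have [] := al_v u us.
have upper : (size al <= size p * size D')%N.
  rewrite -(size_allpairs (fun v b => b * v)); apply: (steinitz QF ial) => v /alS.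
  apply: span_trans => _ /allpairsP[[u z] /= [us zD ->]].
  rewrite (sZ u z us (DZ z zD)); have [c ca ->] := aP u us.
  rewrite mulr_sumr; apply: (big_ind (lspan K _)); [exact: span0|exact: spanD|].
  move=> i _; rewrite mulrA; apply: span_products; first exact: DD'.
  exact: mem_nth.
have : ((2 * size p).+1 * size D <= 2 * (size p * size D'))%N.
  apply: leq_trans (leq_trans lower (leq_trans szal _)); last by rewrite leq_mul2l.
  by rewrite leq_mul2r big orbT.
move: szD D0; rewrite mulnA; move: (2 * size p)%N (size D) (size D') => h d d'.
by clear; nia.
Qed.
End ExtensionOfScalars.

(** * Deficient subspaces in fractions of a group algebra *)

Section GroupAlgebraFractions.
Variables (k : fieldType) (G : groupType).
Definition single (c : k) (g : G) : group_algebra k G := (<< c *g g >> : {malg k[G]}).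

Lemma singleM c d g h : single c g * single d h = single (c * d) (g * h)%g.
Proof. exact: ga_mulUU. Qed.

Lemma single_sum (b : group_algebra k G) :
  b = \sum_(g <- msupp (b : {malg k[G]})) single (mcoeff g b) g.
Proof. exact: monalgE. Qed.

Variables (Q : unitRingType) (i : {rmorphism group_algebra k G -> Q}).

Definition scalar (c : k) : Q := i (single c 1%g).

Lemma scalar_is_zmod_morphism : zmod_morphism scalar.
Proof.
move=> c d; rewrite /scalar -rmorphB; congr (i _).
exact: (raddfB (@mkmalgU G k 1%g)).
Qed.

Lemma scalar_is_monoid_morphism : monoid_morphism scalar.
Proof.
split=> [|c d]; first by rewrite /scalar -[RHS](rmorph1 i).
by rewrite /scalar -rmorphM singleM mulg1.
Qed.

HB.instance Definition _ := GRing.isZmodMorphism.Build k Q scalar scalar_is_zmod_morphism.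
HB.instance Definition _ := GRing.isMonoidMorphism.Build k Q scalar scalar_is_monoid_morphism.

Definition scalars : {pred Q} := fun q => `[< exists c, q = scalar c >].

Lemma scalarsP q : reflect (exists c, q = scalar c) (q \in scalars).
Proof. exact: asboolP. Qed.

Lemma scalar_in c : scalar c \in scalars.
Proof. by apply/scalarsP; exists c. Qed.

Lemma scalars_divring_closed : divring_closed scalars.
Proof.
split; first by rewrite -(rmorph1 scalar); apply: scalar_in.
- by move=> _ _ /scalarsP[c ->] /scalarsP[d ->]; rewrite -rmorphB; apply: scalar_in.
- by move=> _ _ /scalarsP[c ->] /scalarsP[d ->]; rewrite -fmorph_div; apply: scalar_in.
Qed.
HB.instance Definition _ := GRing.isDivringClosed.Build Q scalars scalars_divring_closed.

Hypothesis ore : ore_field_of_fractions i.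
Let QF : skew_field Q. Proof. by case: ore. Qed.
Let i_inj : injective i. Proof. by case: ore. Qed.

Lemma i_neq0 b : b != 0 -> i b != 0.
Proof. by apply: contra_neq => ib; apply: i_inj; rewrite ib rmorph0. Qed.

Lemma scalar_single c g : scalar c * i (single 1 g) = i (single c g).
Proof. by rewrite /scalar -(rmorphM i) singleM mulr1 mul1g. Qed.

Lemma scalar_central c q : scalar c * q = q * scalar c.
Proof.
have comm b : scalar c * i b = i b * scalar c.
  rewrite (single_sum b) rmorph_sum mulr_sumr mulr_suml; apply: eq_bigr => g _.
  by rewrite /scalar -!(rmorphM i) !singleM mulg1 mul1g mulrC.
have [_ _ /(_ q)[a [b [b0 ->]]] _] := ore.
rewrite mulrA comm -!mulrA; congr (_ * _).
have ub : i b \is a GRing.unit by apply/QF/i_neq0.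
by apply: (mulrI ub); rewrite mulrA -comm mulrK // mulVKr.
Qed.

Lemma group_indep (F : seq G) : uniq F -> indep scalars [seq i (single 1 g) | g <- F].
Proof.
have spanE s q : lspan scalars [seq i (single 1 g) | g <- s] q ->
    exists2 b : group_algebra k G, q = i b & forall g, g \notin s -> mcoeff g b = 0.
  elim: s q => [|a s IH] q /=.
    by move=> ->; exists 0; rewrite ?rmorph0 // => g _; rewrite mcoeff0.
  move=> [_ /scalarsP[c ->] /IH[b qb bs]]; exists (b + single c a).
    by rewrite rmorphD -qb -(scalar_single c a) subrK.
  move=> g; rewrite inE negb_or => /andP[ga gs].
  by rewrite mcoeffD bs // add0r mcoeffU eq_sym (negPf ga).
elim: F => //= a F IH /andP[aF uF]; split; first exact: IH.
move=> /spanE[b /i_inj <- /(_ a aF)/eqP].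
by rewrite mcoeffUU oner_eq0.
Qed.

(** From [q = b^-1 a] and [r = b'^-1 a'], the left Ore condition gives [d b = e b'],
which is a common denominator. *)
Lemma common_denominator q r : exists a b c : group_algebra k G,
  [/\ c != 0, i c * q = i a & i c * r = i b].
Proof.
have [_ _ _ left_fraction] := ore.
have [a [b [b0 ->]]] := left_fraction q.
have [a' [b' [b'0 ->]]] := left_fraction r.
have [e [d [d0 de]]] := left_fraction (i b * (i b')^-1).
have Ec : i d * i b = i e * i b'.
  have -> : i e = i d * (i b * (i b')^-1) by rewrite de mulVKr ?QF ?i_neq0.
  by rewrite mulrA mulrVK ?QF ?i_neq0.
exists (d * a), (e * a'), (d * b); split.
- apply/eqP => db0; have /eqP : i d * i b = 0 by rewrite -rmorphM db0 rmorph0.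
  by rewrite -(mulr0 (i d)) => /eqP /(mulrI (QF (i_neq0 d0))) /eqP; apply/negP/i_neq0.
- by rewrite !rmorphM -mulrA mulVKr ?QF ?i_neq0.
- by rewrite !rmorphM Ec -mulrA mulVKr ?QF ?i_neq0.
Qed.

(** With [x = c^-1 a] and [y = c^-1 b], take V = D F c, where F is a Foelner set for
the supports of [a], [b], [c] and D is almost invariant under their coefficients.
Then V, Vx and Vy all lie in the span of the products of D' with the slightly larger
set T. *)
Lemma deficient_exists (K : divringClosed Q) (x y : Q) : {subset K <= scalars} ->
  foelner (@whole G) -> exists s, deficient K x y s.
Proof.
move=> KL amenable.
have [a [b [c [c0 ca cb]]]] := common_denominator x y.
pose supp (d : group_algebra k G) := msupp (d : {malg k[G]}) : seq G.
pose coefs (d : group_algebra k G) := [seq scalar (mcoeff g d) | g <- supp d].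
(* Ratios of at most 5/4 suffice, because (5/4)^2 < 2. *)
have [|F [T [uF F0 _ FT szF]]] := amenable (supp a ++ supp b ++ supp c) 4%N.
  by [].
have Lcomm : {in scalars &, forall u v : Q, u * v = v * u}.
  by move=> _ v /scalarsP[d ->] _; apply: scalar_central.
have aL : {subset coefs a ++ coefs b ++ coefs c <= scalars}.
  by move=> u; rewrite !mem_cat => /or3P[] /mapP[g _ ->]; apply: scalar_in.
have [D [D' [iD [DL D'L] D0 DD' szD]]] := commutative_foelner QF KL Lcomm 4%N aL.
pose s0 := [seq m * v | v <- [seq i (single 1 g) | g <- F], m <- D].
pose t := [seq m * v | v <- [seq i (single 1 g) | g <- T], m <- D'].
have is0 : indep K s0 by apply: (tower_indep QF KL _ iD DL); apply: group_indep.
have ic0 := i_neq0 c0.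
have szs0 : size s0 = (size F * size D)%N by rewrite size_allpairs size_map.
have szt : size t = (size T * size D')%N by rewrite size_allpairs size_map.
exists [seq v * i c | v <- s0]; split.
- apply: (indep_map (linear_mulr K (i c))) is0 => v _ vc.
  by rewrite -(mulrK (QF ic0) v) vc mul0r.
- by rewrite size_map szs0 muln_gt0 F0.
exists t.
  by rewrite size_map szt szs0; move: szF szD F0 D0; clear; nia.
have prod (d : group_algebra k G) v : {subset supp d <= supp a ++ supp b ++ supp c} ->
    {subset coefs d <= coefs a ++ coefs b ++ coefs c} -> v \in s0 -> lspan K t (v * i d).
  move=> sd cd /allpairsP[[u m] /= [/mapP[f fF ->] mD ->]].
  rewrite (single_sum d) rmorph_sum mulr_sumr big_seq.
  apply: (big_ind (lspan K t)); [exact: span0|exact: spanD|] => g gd.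
  rewrite -mulrA -rmorphM singleM mul1r -(scalar_single _ (f * g)%g) mulrA.
  apply: span_products; last by apply: map_f; apply: FT => //; apply: sd.
  by apply: DD' => //; apply: cd; apply: map_f.
move=> _ /mapP[v vs ->]; split.
- by apply: prod => // u us; rewrite !mem_cat us !orbT.
- by rewrite -mulrA ca; apply: prod => // u us; rewrite !mem_cat us.
- by rewrite -mulrA cb; apply: prod => // u us; rewrite !mem_cat us !orbT.
Qed.
End GroupAlgebraFractions.

(** * Centres of subfields and free fields *)

Section Subfields.
Variables (Q : unitRingType) (QF : skew_field Q) (S : divringClosed Q).

Lemma subskewfield_field : skew_field (subskewfield S).
Proof.
move=> e e0; have v0 : val e != 0 by rewrite -(inj_eq val_inj) in e0.
have vS : (val e)^-1 \in S by rewrite rpredV; apply: valP.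
apply/unitrP; exists (Subskewfield vS).
by split; apply: val_inj; rewrite rmorphM rmorph1 /= ?mulVr ?mulrV ?QF.
Qed.

Definition centre : {pred Q} := fun z => `[< z \in S /\ forall e, e \in S -> z * e = e * z >].

Lemma centreP z : reflect (z \in S /\ forall e, e \in S -> z * e = e * z) (z \in centre).
Proof. exact: asboolP. Qed.

Lemma centre_divring_closed : divring_closed centre.
Proof.
split.
- by apply/centreP; split=> [|e _]; rewrite ?rpred1 // mul1r mulr1.
- move=> a b /centreP[aS ac] /centreP[bS bc]; apply/centreP.
  by split=> [|e eS]; rewrite ?rpredB // mulrBl mulrBr ac ?bc.
- move=> a b /centreP[aS ac] /centreP[bS bc]; apply/centreP.
  split=> [|e eS]; first by rewrite rpred_div.
  rewrite mulrA -ac // -!mulrA; congr (_ * _).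
  have [ub|nub] := boolP (b \is a GRing.unit); last by rewrite invr_out // bc.
  by apply: (mulrI ub); rewrite mulVKr // mulrA bc // mulrK.
Qed.
HB.instance Definition _ := GRing.isDivringClosed.Build Q centre centre_divring_closed.

(** In a shortest dependence over [S] of elements that commute with [S], commuting
with an element of [S] gives a dependence between the preceding elements, so that
the coefficients commute with [S]. *)
Lemma indep_over_centre s : (forall v e, v \in s -> e \in S -> v * e = e * v) ->
  indep centre s -> indep S s.
Proof.
elim: s => //= a s IH sc [is_ na].
have sc' v e : v \in s -> e \in S -> v * e = e * v.
  by move=> vs; apply: sc; rewrite inE vs orbT.
have iS := IH sc' is_; split=> // /span_coef[c cS Da]; apply: na.
rewrite Da; apply: span_sum => [j|j]; last by apply: span_mem; apply: mem_nth.
apply/centreP; split=> // e eS; apply/eqP; rewrite -subr_eq0; apply/eqP.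
apply: (indep_coef QF (c := fun j => c j * e - e * c j) iS) => [l|].
  by rewrite rpredB // rpredM.
transitivity (a * e - e * a); last by rewrite (sc a e) ?mem_head // subrr.
rewrite Da mulr_suml mulr_sumr -sumrB; apply: eq_bigr => l _.
by rewrite mulrBl -!mulrA (sc' _ _ (mem_nth 0 (ltn_ord l)) eS).
Qed.
End Subfields.

Section FreeField.
Variables (E : unitRingType) (EF : skew_field E) (X : choiceType) (U Q : unitRingType).
Variables (j : {rmorphism free_ring E X -> U}) (f : {rmorphism U -> Q}).
Hypothesis jfree : free_field j.

(** A full matrix becomes invertible in the free field, hence also in [Q], and then
its kernel is zero. *)
Lemma free_field_singular n (A : 'M[free_ring E X]_n.+1) (q : 'rV[Q]_n.+1) :
  q != 0 -> q *m map_mx (f \o j) A = 0 ->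
  exists (B : 'M_(n.+1, n)) (C : 'M_(n, n.+1)), A = B *m C.
Proof.
move=> q0 qA; apply: contrapT => nfull.
have Afull : full A by move=> B C AE; apply: nfull; exists B, C.
have [_ _ _ /(_ n A Afull)[B [AB _]]] := jfree.
move/eqP: q0; apply; rewrite -[q]mulmx1 -(map_mx1 f) -AB map_mxM mulmxA.
by rewrite -map_mx_comp qA mul0mx.
Qed.

Lemma generator_comm (z : X) (e : E) : f (j (letter E z)) * f (j (free_ringC X e)) =
  f (j (free_ringC X e)) * f (j (letter E z)).
Proof.
set a : free_ring E X := letter E z; set b := free_ringC X e.
have ab : a * b = b * a by exact: letter_cst.
clearbody a b; transitivity (f (j (a * b))).
  by rewrite (rmorphM j) (rmorphM f).
by rewrite ab (rmorphM j) (rmorphM f).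
Qed.

(** The matrices [J], [A] and [B] write V, Vx and Vy in terms of [u], with right
coefficients in [E]. *)
Lemma free_field_doubles (x y : X) (h N : nat) (p : 'rV[Q]_h) (u : 'rV[Q]_N)
    (J A B : 'M[E]_(N, h)) :
  x != y -> (0 < h)%N ->
  (forall w : 'cV[E]_h, p *m map_mx (fun e => f (j (free_ringC X e))) w = 0 -> w = 0) ->
  p = u *m map_mx (fun e => f (j (free_ringC X e))) J ->
  p *m (f (j (letter E x)))%:M = u *m map_mx (fun e => f (j (free_ringC X e))) A ->
  p *m (f (j (letter E y)))%:M = u *m map_mx (fun e => f (j (free_ringC X e))) B ->
  (h + h < N)%N.
Proof.
move=> xy h0 pfree pJ pA pB.
pose c : {rmorphism E -> free_ring E X} := @malgC {fmonom X} E.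
pose e : {rmorphism free_ring E X -> E} := @mcoeff {fmonom X} E mone.
pose dx : {additive free_ring E X -> free_ring E X} := fox x.
pose dy : {additive free_ring E X -> free_ring E X} := fox y.
have ec z : e (c z) = z by exact: mcoeffUU.
have xc z : letter E x * c z = c z * letter E x by exact: letter_cst.
have yc z : letter E y * c z = c z * letter E y by exact: letter_cst.
have dxM g g' : fox_rule dx (c \o e) g g' by exact: foxM.
have dyM g g' : fox_rule dy (c \o e) g g' by exact: foxM.
have dxc z : dx (c z) = 0 by exact: fox_cst.
have dyc z : dy (c z) = 0 by exact: fox_cst.
have dxx : dx (letter E x) = 1 by rewrite -[LHS]/(fox x _) fox_letter eqxx.
have dxy : dx (letter E y) = 0 by rewrite -[LHS]/(fox x _) fox_letter (negPf xy).
have dyx : dy (letter E x) = 0 by rewrite -[LHS]/(fox y _) fox_letter eq_sym (negPf xy).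
have dyy : dy (letter E y) = 1 by rewrite -[LHS]/(fox y _) fox_letter eqxx.
have sing := free_field_singular.
have := free_pair_doubles EF ec xc yc dxM dyM dxc dyc dxx dxy dyx dyy sing.
by move=> /(_ h N p u J A B h0 pfree pJ pA pB).
Qed.
End FreeField.

(** * The main theorem *)

Section Meet.
Variables (Q : unitRingType) (S L : divringClosed Q).
Definition meet_subfield : {pred Q} := [pred q | (q \in S) && (q \in L)].
Lemma meet_divring_closed : divring_closed meet_subfield.
Proof.
split=> [|a b|a b]; rewrite !inE ?rpred1 // => /andP[aS aL] /andP[bS bL].
  by rewrite !rpredB.
by rewrite !rpred_div.
Qed.
HB.instance Definition _ :=
  GRing.isDivringClosed.Build Q meet_subfield meet_divring_closed.
End Meet.

Lemma coefficient_matrix (Q : unitRingType) (S : divringClosed Q) (s : seq Q) h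
    (w : 'I_h -> Q) :
  (forall v e, v \in s -> e \in S -> v * e = e * v) ->
  (forall j, lspan (centre S) s (w j)) ->
  exists M : 'M[subskewfield S]_(size s, h),
    \row_j w j = (\row_l s`_l) *m map_mx val M.
Proof.
move=> sS sw.
have /choice[c cP] j : exists c : 'I_(size s) -> Q,
    (forall l, c l \in centre S) /\ w j = \sum_l c l * s`_l.
  by have [c cZ Dw] := span_coef (sw j); exists c.
have cS j l : c j l \in S by have [/(_ l)/centreP[]] := cP j.
exists (\matrix_(l, j) Subskewfield (cS j l)); apply/rowP => j; rewrite !mxE.
have [_ ->] := cP j; apply: eq_bigr => l _; rewrite !mxE /=.
by rewrite (sS s`_l (c j l)) // mem_nth.
Qed.

Theorem corollary5p3 (k : fieldType) (G : groupType)
    (Gnonab : nonabelian G) (Gtf : torsion_free G) (Gpf : polycyclic_by_finite G)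
    (Q : unitRingType) (i : {rmorphism group_algebra k G -> Q})
    (Qfrac : ore_field_of_fractions i) :
  ~ contains_noncommutative_free_field Q.
Proof.
have QF : skew_field Q by case: Qfrac.
move=> [S [X [U [j [[x0 [y0 xy0]] jfree [f [_ fE]]]]]]].
pose E := subskewfield S.
pose x := f (j (letter E x0)); pose y := f (j (letter E y0)).
pose K : divringClosed Q := meet_subfield S (scalars i).
have KL : {subset K <= scalars i} by move=> q /andP[].
have KS : {subset K <= S} by move=> q /andP[].
have Kcentral c v : c \in K -> c * v = v * c.
  by move=> /KL /scalarsP[d ->]; apply: scalar_central.
have letterS z e : e \in S -> f (j (letter E z)) * e = e * f (j (letter E z)).
  move=> eS; have -> : e = f (j (free_ringC X (Subskewfield eS))) by rewrite fE.
  exact: generator_comm.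
have [s ms s1] := minimal_with_one QF Kcentral
  (deficient_exists Qfrac x y KL (foelner_polycyclic_by_finite Gpf)).
have sS v e : v \in s -> e \in S -> v * e = e * v.
  move=> vs eS; apply: (minimal_centralizes QF Kcentral ms s1); try exact: letterS.
  exact: span_mem.
have KZ : {subset K <= centre S}.
  by move=> c cK; apply/centreP; split=> [|e _]; [exact: KS|exact: Kcentral].
have Zcomm : {in centre S &, forall a b : Q, a * b = b * a}.
  by move=> a b /centreP[_ ac] /centreP[bS _]; apply: ac.
have Zxy z : z \in centre S -> z * x = x * z /\ z * y = y * z.
  by move=> /centreP[zS _]; rewrite /x /y !letterS.
have sZ v z : v \in s -> z \in centre S -> v * z = z * v.
  by move=> vs /centreP[zS _]; apply: sS.
have [p [u [[ip p0] sub_ps sub_us pu szu]]] :=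
  deficient_over_extension QF KZ Zcomm Zxy ms sZ.
have uS v e : v \in u -> e \in S -> v * e = e * v.
  move=> /sub_us + eS; rewrite !mem_cat => /or3P[|/mapP[w ws ->]|/mapP[w ws ->]].
  - by move=> vs; apply: sS.
  - by rewrite -mulrA letterS // !mulrA (sS w e).
  - by rewrite -mulrA letterS // !mulrA (sS w e).
have pS v e : v \in p -> e \in S -> v * e = e * v by move=> /sub_ps; apply: sS.
have pj (l : 'I_(size p)) : p`_l \in p by apply: mem_nth.
have [J DJ] := coefficient_matrix (w := fun l : 'I_(size p) => p`_l) uS
  (fun l => let: And3 h _ _ := pu _ (pj l) in h).
have [A DA] := coefficient_matrix (w := fun l : 'I_(size p) => p`_l * x) uS
  (fun l => let: And3 _ h _ := pu _ (pj l) in h).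
have [B DB] := coefficient_matrix (w := fun l : 'I_(size p) => p`_l * y) uS
  (fun l => let: And3 _ _ h := pu _ (pj l) in h).
have vE n m (M : 'M[E]_(n, m)) : map_mx (fun e => f (j (free_ringC X e))) M = map_mx val M.
  by apply/matrixP => a b; rewrite !mxE fE.
have scale z : (\row_l p`_l) *m z%:M = \row_(l < size p) (p`_l * z).
  apply/rowP => l; rewrite !mxE (bigD1 l) //= !mxE eqxx mulr1n.
  by rewrite big1 ?addr0 // => m ml; rewrite !mxE (negPf ml) mulr0n mulr0.
suff : (size p + size p < size u)%N by rewrite addnn -mul2n ltnNge szu.
apply: (free_field_doubles (@subskewfield_field Q QF S) jfree (x := x0) (y := y0)
  (f := f) (p := \row_l p`_l) (u := \row_l u`_l) (J := J) (A := A) (B := B)) => //.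
- exact/eqP.
- move=> w; rewrite vE => pw; apply/colP => l; rewrite mxE; apply: val_inj.
  have iS := indep_over_centre QF pS ip.
  apply: (indep_coef QF (c := fun l => val (w l ord0)) iS) => [m|]; first exact: valP.
  move/matrixP/(_ ord0 ord0): pw; rewrite !mxE => pw; rewrite -[RHS]pw.
  by apply: eq_bigr => m _; rewrite !mxE (pS p`_m) //; apply: valP.
- by rewrite vE.
- by rewrite vE scale.
- by rewrite vE scale.
Qed.
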